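(* Let $q\in\mathbb{C}$. (1) Let $P(y,q)=\prod_{j\in[0,n]\setminus\{1\}}(y-[n-j]_q)$. Then $P(\mathcal{B}^*_n(q),q)=0=P(\mathcal{B}_n(q),q)$ in $\mathcal{H}_n(q)$. (2) The characteristic polynomial of the right multiplication maps $x\mapsto x\mathcal{B}^*_n(q)$ and $x\mapsto x\mathcal{B}_n(q)$ on $\mathcal{H}_n(q)$ is $\chi(y,q)=\prod_{j=0}^{n}(y-[n-j]_q)^{m_{n-j}}$ with $m_{n-j}=\binom{n}{j}d_j$. (3) If $\mathcal{H}_n(q)$ is semisimple, then $\mathcal{B}^*_n(q)$ and $\mathcal{B}_n(q)$ act semisimply (diagonalizably) on $\mathcal{H}_n(q)$ by right multiplication. (4) If $\mathcal{H}_n(q)$ is semisimple, then the kernels of these right multiplication maps both have dimension $d_n$.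
   Context: $\mathcal{H}_n(q)$ is the Type A Iwahori–Hecke algebra over $\mathbb{C}$ with generators $T_{s_1},\dots,T_{s_{n-1}}$ and relations $T_{s_i}^2=(q-1)T_{s_i}+q$, $T_{s_i}T_{s_j}=T_{s_j}T_{s_i}$ ($|i-j|\ge2$), $T_{s_i}T_{s_{i+1}}T_{s_i}=T_{s_{i+1}}T_{s_i}T_{s_{i+1}}$. $\mathcal{B}_n(q)=\sum_{i=1}^{n}T_{s_{n-1}}\cdots T_{s_i}$, $\mathcal{B}^*_n(q)=\sum_{j=1}^{n}T_{s_j}\cdots T_{s_{n-1}}$ (empty products equal $1$). $[m]_q=1+q+\dots+q^{m-1}$ for $m>0$, $[0]_q=0$. $d_j$ is the number of fixed-point-free permutations of $\mathfrak{S}_j$, with $d_0=1$. $\mathcal{H}_n(q)$ is semisimple iff $q\neq0$ and $q$ is not a primitive $k$-th root of unity for $2\le k\le n$. *)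

(* Defs.v *)
From HB Require Import structures.
From mathcomp Require Import all_boot all_order all_fingroup all_algebra all_field.
From mathcomp Require Import boolp reals.
From mathcomp.real_closed Require Import complex.

Set Implicit Arguments.
Unset Strict Implicit.
Unset Printing Implicit Defensive.

Import GRing.Theory.

Local Open Scope ring_scope.
Local Open Scope quotient_scope.

(* The Iwahori-Hecke algebra H_n(q) is built from its presentation: formal     *)
(* expressions in n - 1 generators with coefficients in K, modulo the smallest *)
(* congruence containing the axioms of unital associative K-algebras and the   *)
(* defining relations.  Generators are indexed from 0, so [HGen i] stands for  *)
(* T_{s_{i+1}}.                                                                *)

Inductive hterm (K : Type) (n : nat) : Type :=
| HCst of K
| HGen of 'I_n.-1
| HAdd of hterm K n & hterm K n
| HMul of hterm K n & hterm K n.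

Arguments HCst {K n} _.
Arguments HGen {K n} _.

HB.instance Definition _ (K : Type) (n : nat) := gen_eqMixin (hterm K n).
HB.instance Definition _ (K : Type) (n : nat) := gen_choiceMixin (hterm K n).

Inductive heq (K : fieldType) (n : nat) (q : K) : hterm K n -> hterm K n -> Prop :=
| heq_refl x : heq q x x
| heq_sym x y : heq q x y -> heq q y x
| heq_trans x y z : heq q x y -> heq q y z -> heq q x z
| heq_add x x' y y' : heq q x x' -> heq q y y' -> heq q (HAdd x y) (HAdd x' y')
| heq_mul x x' y y' : heq q x x' -> heq q y y' -> heq q (HMul x y) (HMul x' y')
| heq_addA x y z : heq q (HAdd x (HAdd y z)) (HAdd (HAdd x y) z)
| heq_addC x y : heq q (HAdd x y) (HAdd y x)
| heq_add0 x : heq q (HAdd (HCst 0) x) x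
| heq_mulA x y z : heq q (HMul x (HMul y z)) (HMul (HMul x y) z)
| heq_mul1l x : heq q (HMul (HCst 1) x) x
| heq_mul1r x : heq q (HMul x (HCst 1)) x
| heq_mul0 x : heq q (HMul (HCst 0) x) (HCst 0)
| heq_mulDl x y z : heq q (HMul (HAdd x y) z) (HAdd (HMul x z) (HMul y z))
| heq_mulDr x y z : heq q (HMul x (HAdd y z)) (HAdd (HMul x y) (HMul x z))
| heq_cstD a b : heq q (HCst (a + b)) (HAdd (HCst a) (HCst b))
| heq_cstM a b : heq q (HCst (a * b)) (HMul (HCst a) (HCst b))
| heq_cstC a x : heq q (HMul (HCst a) x) (HMul x (HCst a))
| heq_quad (i : 'I_n.-1) :
    heq q (HMul (HGen i) (HGen i)) (HAdd (HMul (HCst (q - 1)) (HGen i)) (HCst q))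
| heq_comm (i j : 'I_n.-1) : (i.+2 <= j)%N ->
    heq q (HMul (HGen i) (HGen j)) (HMul (HGen j) (HGen i))
| heq_braid (i j : 'I_n.-1) : j = i.+1 :> nat ->
    heq q (HMul (HGen i) (HMul (HGen j) (HGen i)))
          (HMul (HGen j) (HMul (HGen i) (HGen j))).

Definition heqb (K : fieldType) (n : nat) (q : K) : rel (hterm K n) :=
  fun x y => `[< heq q x y >].

Arguments heqb {K} n q _ _.

Section HeckeQuotient.
Variables (K : fieldType) (n : nat) (q : K).
Implicit Types x y z : hterm K n.

Lemma heqb_refl : reflexive (heqb n q).
Proof. by move=> x; apply/asboolP; apply: heq_refl. Qed.

Lemma heqb_sym : symmetric (heqb n q).
Proof. by move=> x y; apply/asboolP/asboolP; apply: heq_sym. Qed.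

Lemma heqb_trans : transitive (heqb n q).
Proof. by move=> y x z /asboolP xy /asboolP yz; apply/asboolP; apply: heq_trans yz. Qed.

Canonical heqb_equiv := EquivRel (heqb n q) heqb_refl heqb_sym heqb_trans.

End HeckeQuotient.

Definition hecke (K : fieldType) (n : nat) (q : K) : Type := {eq_quot heqb n q}.

Section HeckeAlgebra.
Variables (K : fieldType) (n : nat) (q : K).
Local Notation H := (hecke n q).
Local Notation Q := {eq_quot heqb n q}.

HB.instance Definition _ := Choice.on H.

Definition hclass (x : hterm K n) : H := \pi_Q x.
Definition hrepr (u : H) : hterm K n := @generic_quotient.repr _ Q u.

Lemma hreprK : cancel hrepr hclass.
Proof. by move=> u; rewrite /hclass /hrepr generic_quotient.reprK. Qed.

Lemma hclassP x y : hclass x = hclass y <-> heq q x y.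
Proof.
split=> [xy|xy]; first by apply/asboolP; apply/(@eqmodP _ (heqb_equiv n q)).
by apply/(@eqmodP _ (heqb_equiv n q)); apply/asboolP.
Qed.

Lemma hrepr_class x : heq q (hrepr (hclass x)) x.
Proof. by apply/hclassP; rewrite hreprK. Qed.

End HeckeAlgebra.

HB.lock Definition hadd (K : fieldType) (n : nat) (q : K) (u v : hecke n q) :
  hecke n q := hclass q (HAdd (hrepr u) (hrepr v)).

HB.lock Definition hmul (K : fieldType) (n : nat) (q : K) (u v : hecke n q) :
  hecke n q := hclass q (HMul (hrepr u) (hrepr v)).

HB.lock Definition hscale (K : fieldType) (n : nat) (q : K) (a : K)
  (u : hecke n q) : hecke n q := hclass q (HMul (HCst a) (hrepr u)).

Section HeckeAlgebraTheory.
Variables (K : fieldType) (n : nat) (q : K).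
Local Notation H := (hecke n q).
Local Notation hclass := (@hclass K n q).
Local Notation hadd := (@hadd K n q).
Local Notation hmul := (@hmul K n q).
Local Notation hscale := (@hscale K n q).

Definition hopp (u : H) : H := hscale (- 1) u.

Lemma hclassD x y : hclass (HAdd x y) = hadd (hclass x) (hclass y).
Proof.
rewrite hadd.unlock; apply/hclassP.
by apply: heq_add; apply/heq_sym/hrepr_class.
Qed.

Lemma hclassM x y : hclass (HMul x y) = hmul (hclass x) (hclass y).
Proof.
rewrite hmul.unlock; apply/hclassP.
by apply: heq_mul; apply/heq_sym/hrepr_class.
Qed.

Lemma hclassZ a x : hscale a (hclass x) = hmul (hclass (HCst a)) (hclass x).
Proof.
rewrite -hclassM hscale.unlock; apply/hclassP.
by apply: heq_mul; [apply: heq_refl | apply: hrepr_class].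
Qed.

Lemma hclass_ind (P : H -> Prop) : (forall x, P (hclass x)) -> forall u, P u.
Proof. by move=> hP u; rewrite -[u]hreprK. Qed.

Lemma haddA : associative hadd.
Proof.
elim/hclass_ind=> x; elim/hclass_ind=> y; elim/hclass_ind=> z.
by rewrite -!hclassD; apply/hclassP; apply: heq_addA.
Qed.

Lemma haddC : commutative hadd.
Proof.
elim/hclass_ind=> x; elim/hclass_ind=> y.
by rewrite -!hclassD; apply/hclassP; apply: heq_addC.
Qed.

Lemma hadd0 : left_id (hclass (HCst 0)) hadd.
Proof. by elim/hclass_ind=> x; rewrite -hclassD; apply/hclassP; apply: heq_add0. Qed.

Lemma hmulA : associative hmul.
Proof.
elim/hclass_ind=> x; elim/hclass_ind=> y; elim/hclass_ind=> z.
by rewrite -!hclassM; apply/hclassP; apply: heq_mulA.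
Qed.

Lemma hmul1l : left_id (hclass (HCst 1)) hmul.
Proof. by elim/hclass_ind=> x; rewrite -hclassM; apply/hclassP; apply: heq_mul1l. Qed.

Lemma hmul1r : right_id (hclass (HCst 1)) hmul.
Proof. by elim/hclass_ind=> x; rewrite -hclassM; apply/hclassP; apply: heq_mul1r. Qed.

Lemma hmulDl : left_distributive hmul hadd.
Proof.
elim/hclass_ind=> x; elim/hclass_ind=> y; elim/hclass_ind=> z.
by rewrite -!(hclassM, hclassD); apply/hclassP; apply: heq_mulDl.
Qed.

Lemma hmulDr : right_distributive hmul hadd.
Proof.
elim/hclass_ind=> x; elim/hclass_ind=> y; elim/hclass_ind=> z.
by rewrite -!(hclassM, hclassD); apply/hclassP; apply: heq_mulDr.
Qed.

Lemma hcstD a b :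
  hclass (HCst (a + b)) = hadd (hclass (HCst a)) (hclass (HCst b)).
Proof. by rewrite -hclassD; apply/hclassP; apply: heq_cstD. Qed.

Lemma hcstM a b :
  hclass (HCst (a * b)) = hmul (hclass (HCst a)) (hclass (HCst b)).
Proof. by rewrite -hclassM; apply/hclassP; apply: heq_cstM. Qed.

Lemma hscaleE a u : hscale a u = hmul (hclass (HCst a)) u.
Proof. by elim/hclass_ind: u => x; exact: hclassZ. Qed.

Lemma hcstC a u : hmul (hclass (HCst a)) u = hmul u (hclass (HCst a)).
Proof.
by elim/hclass_ind: u => x; rewrite -!hclassM; apply/hclassP; apply: heq_cstC.
Qed.

Lemma haddN : left_inverse (hclass (HCst 0)) hopp hadd.
Proof.
move=> u; rewrite /hopp hscaleE -{2}[u]hmul1l -hmulDl -hcstD addNr.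
by elim/hclass_ind: u => x; rewrite -hclassM; apply/hclassP; apply: heq_mul0.
Qed.

(* The trivial character T_{s_i} |-> q shows that H_n(q) is not the zero ring. *)
Fixpoint hindex (x : hterm K n) : K :=
  match x with
  | HCst a => a
  | HGen _ => q
  | HAdd y z => hindex y + hindex z
  | HMul y z => hindex y * hindex z
  end.

Lemma hindex_heq x y : heq q x y -> hindex x = hindex y.
Proof.
elim=> //=.
- by move=> {}x {}y z _ -> _ ->.
- by move=> {}x x' {}y y' _ -> _ ->.
- by move=> {}x x' {}y y' _ -> _ ->.
- by move=> *; rewrite addrA.
- by move=> *; rewrite addrC.
- by move=> *; rewrite add0r.
- by move=> *; rewrite mulrA.
- by move=> *; rewrite mul1r.
- by move=> *; rewrite mulr1.
- by move=> *; rewrite mul0r.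
- by move=> *; rewrite mulrDl.
- by move=> *; rewrite mulrDr.
- by move=> *; rewrite mulrC.
- by move=> *; rewrite mulrBl mul1r subrK.
Qed.

Lemma hone_neq0 : hclass (HCst 1) != hclass (HCst 0) :> H.
Proof. by apply/eqP => /hclassP /hindex_heq /= /eqP; rewrite oner_eq0. Qed.

HB.instance Definition _ := GRing.isZmodule.Build H haddA haddC hadd0 haddN.

HB.instance Definition _ := GRing.Zmodule_isNzRing.Build H
  hmulA hmul1l hmul1r hmulDl hmulDr hone_neq0.

Lemma hscaleA (a b : K) (v : H) : hscale a (hscale b v) = hscale (a * b) v.
Proof. by rewrite !hscaleE hmulA -hcstM. Qed.

Lemma hscale1 : left_id 1 hscale.
Proof. by move=> v; rewrite hscaleE hmul1l. Qed.

Lemma hscaleDr : right_distributive hscale +%R.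
Proof. by move=> a u v; rewrite !hscaleE hmulDr. Qed.

Lemma hscaleDl (v : H) : {morph hscale^~ v : a b / a + b}.
Proof. by move=> a b; rewrite !hscaleE hcstD hmulDl. Qed.

HB.instance Definition _ := GRing.Zmodule_isLmodule.Build K H
  hscaleA hscale1 hscaleDr hscaleDl.

Lemma hscaleAl (a : K) (u v : H) : a *: (u * v) = (a *: u) * v.
Proof. by rewrite /GRing.scale/= !hscaleE; apply: hmulA. Qed.

HB.instance Definition _ := GRing.Lmodule_isLalgebra.Build K H hscaleAl.

Lemma hscaleAr (a : K) (u v : H) : a *: (u * v) = u * (a *: v).
Proof.
rewrite /GRing.scale/= !hscaleE /GRing.mul/= hmulA.
by rewrite hcstC -hmulA.
Qed.

HB.instance Definition _ := GRing.Lalgebra_isAlgebra.Build K H hscaleAr.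

Definition heckeT (i : 'I_n.-1) : H := hclass (HGen i).

Lemma hclass_cst a : hclass (HCst a) = a%:A.
Proof. by rewrite /GRing.scale/= hscaleE [hmul _ 1]hmul1r. Qed.

Lemma hclass_add x y : hclass (HAdd x y) = hclass x + hclass y.
Proof. exact: hclassD. Qed.

Lemma hclass_mul x y : hclass (HMul x y) = hclass x * hclass y.
Proof. exact: hclassM. Qed.

Lemma heckeT_quad i : heckeT i * heckeT i = (q - 1) *: heckeT i + q%:A.
Proof.
rewrite -[_ *: heckeT i]mulr_algl -!hclass_cst.
rewrite -[in RHS](hclass_mul _ (HGen i)) -hclass_add -hclass_mul.
by apply/hclassP; apply: heq_quad.
Qed.

Lemma heckeT_comm (i j : 'I_n.-1) : (i.+2 <= j)%N ->
  heckeT i * heckeT j = heckeT j * heckeT i.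
Proof. by move=> ij; rewrite -!hclass_mul; apply/hclassP; apply: heq_comm. Qed.

Lemma heckeT_braid (i j : 'I_n.-1) : j = i.+1 :> nat ->
  heckeT i * (heckeT j * heckeT i) = heckeT j * (heckeT i * heckeT j).
Proof. by move=> ij; have /hclassP := heq_braid q ij; rewrite !hclass_mul. Qed.

Lemma hecke_ind (P : H -> Prop) :
  (forall a, P a%:A) -> (forall i, P (heckeT i)) ->
  (forall u v, P u -> P v -> P (u + v)) ->
  (forall u v, P u -> P v -> P (u * v)) -> forall u, P u.
Proof.
move=> Pc Pg Pa Pm; elim/hclass_ind; elim=> [a|i|x Px y Py|x Px y Py].
- by rewrite hclass_cst; apply: Pc.
- exact: Pg.
- by rewrite hclass_add; apply: Pa.
- by rewrite hclass_mul; apply: Pm.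
Qed.

End HeckeAlgebraTheory.

Section FiniteSpan.
Variables (K : fieldType) (V : lmodType K).

Definition spans (N : nat) (b : 'I_N -> V) : Prop :=
  forall v, exists c : 'I_N -> K, v = \sum_i c i *: b i.

Lemma spans_findim N (b : 'I_N -> V) : spans b -> {d : nat & Vector.axiom d V}.
Proof.
move=> sp.
have exN : exists N, `[< exists b : 'I_N -> V, spans b >].
  by exists N; apply/asboolP; exists b.
case: (ex_minnP exN) => {N b sp exN} d /asboolP /cid [b sp] dmin.
pose f (r : 'rV[K]_d) : V := \sum_i r 0 i *: b i.
have fD a r s : f (a *: r + s) = a *: f r + f s.
  rewrite /f scaler_sumr -big_split; apply: eq_bigr => i _ /=.
  by rewrite !mxE scalerDl scalerA.
have f_inj0 r : f r = 0 -> r = 0.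
  move=> fr0; apply/eqP; apply/negPn/negP => /rV0Pn [i0 ri0].
  rewrite /f in fr0; move: r i0 ri0 fr0 {f fD}.
  case: d => [|d] in b sp dmin * => r i0 ri0 fr0; first by case: i0 {ri0}.
  have : (d.+1 <= d)%N; last by rewrite ltnn.
  apply: dmin; apply/asboolP; exists (fun i => b (lift i0 i)) => v.
  have [c ->] := sp v.
  exists (fun i => c (lift i0 i) - c i0 / r 0 i0 * r 0 (lift i0 i)).
  have -> : \sum_i c i *: b i =
      \sum_i c i *: b i - (c i0 / r 0 i0) *: \sum_i r 0 i *: b i.
    by rewrite fr0 scaler0 subr0.
  rewrite scaler_sumr -sumrB.
  rewrite (bigD1_ord i0) //= scalerA divfK // subrr add0r.
  by apply: eq_bigr => i _; rewrite scalerBl scalerA.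
have f_inj : injective f.
  move=> r s frs; apply/eqP; rewrite -subr_eq0; apply/eqP/f_inj0.
  by rewrite addrC -scaleN1r fD frs scaleN1r addNr.
have f_surj v : exists r, f r = v.
  have [c ->] := sp v; exists (\row_i c i).
  by apply: eq_bigr => i _; rewrite mxE.
have [g gK] := boolp.choice f_surj.
exists d; exists g.
  by move=> a u v; apply: f_inj; rewrite fD !gK.
by exists f => // r; apply: f_inj; rewrite gK.
Qed.

End FiniteSpan.

(* H_n(q) is finite dimensional: H_{m+2} is spanned by the right translates of *)
(* H_{m+1} by the descending products T_{s_{m+1}} ... T_{s_k}.                 *)
Section FiniteDimension.
Variables (K : fieldType) (n : nat) (q : K).
Local Notation H := (hecke n q).

Let t (k : nat) : H := oapp (@heckeT K n q) 0 (insub k).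

Let tE (k : nat) (kn : (k < n.-1)%N) : t k = heckeT q (Ordinal kn).
Proof. by rewrite /t insubT. Qed.

Let t_quad k : (k < n.-1)%N -> t k * t k = (q - 1) *: t k + q%:A.
Proof. by move=> kn; rewrite (tE kn) heckeT_quad. Qed.

Let t_comm i j : (i.+2 <= j)%N -> (j < n.-1)%N -> t i * t j = t j * t i.
Proof.
move=> ij jn; have iN : (i < n.-1)%N by apply: leq_trans jn; rewrite ltnS ltnW // ltnW.
by rewrite (tE jn) (tE iN) heckeT_comm.
Qed.

Let t_braid i : (i.+1 < n.-1)%N -> t i * (t i.+1 * t i) = t i.+1 * (t i * t i.+1).
Proof.
move=> jn; have iN : (i < n.-1)%N by apply: ltnW.
by rewrite (tE jn) (tE iN) heckeT_braid.
Qed.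

Let D (m k : nat) : H := \prod_(j <- rev (index_iota k m.+1)) t j.

Let D1 m : D m m.+1 = 1.
Proof. by rewrite /D /index_iota subnn big_nil. Qed.

Let DS m k : (k <= m)%N -> D m k = D m k.+1 * t k.
Proof.
by move=> km; rewrite /D /index_iota subSn // /= rev_cons -cats1 big_cat big_seq1 subSS.
Qed.

Let D_far m k j : (j.+1 < k)%N -> (m < n.-1)%N -> D m k * t j = t j * D m k.
Proof.
move=> jk mn; symmetry; rewrite /D big_seq; apply: commr_prod => i.
rewrite mem_rev mem_index_iota => /andP [ki im].
by apply: t_comm; [apply: leq_trans ki | apply: leq_trans mn].
Qed.

Let D_shift m k i : (k <= i)%N -> (i < m)%N -> (m < n.-1)%N ->
  D m k * t i.+1 = t i * D m k.
Proof.
move=> ki im mn; have [e] := ubnP (i - k); elim: e => // e IHe in k ki *.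
move=> ike; have [ik|neq] := eqVneq i k.
  rewrite -ik (DS (ltnW im)) (DS im).
  rewrite -!mulrA -t_braid; last exact: leq_ltn_trans im mn.
  rewrite mulrA D_far //.
  by rewrite !mulrA.
have {neq} kli : (k < i)%N by rewrite ltn_neqAle eq_sym neq.
rewrite (DS (leq_trans ki (ltnW im))).
rewrite -mulrA (t_comm _ (leq_ltn_trans im mn)) //.
rewrite mulrA IHe ?mulrA //.
by rewrite subnS; case: (i - k)%N (subn_gt0 k i) ike => [|l] //=; rewrite kli.
Qed.

Fixpoint hspan (m : nat) (x : H) : Prop :=
  if m is m'.+1 then
    exists f : 'I_m'.+2 -> H,
      (forall k, hspan m' (f k)) /\ x = \sum_k f k * D m' k
  else exists a : K, x = a%:A.

Let hspan0 m : hspan m 0.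
Proof.
elim: m => [|m IHm]; first by exists 0; rewrite scale0r.
by exists (fun _ => 0); split=> //; rewrite big1 // => k _; rewrite mul0r.
Qed.

Let hspanD m x y : hspan m x -> hspan m y -> hspan m (x + y).
Proof.
elim: m => [|m IHm] in x y *.
  by move=> [a ->] [b ->]; exists (a + b); rewrite scalerDl.
move=> [f [fm ->]] [g [gm ->]]; exists (fun k => f k + g k); split.
  by move=> k; apply: IHm; [exact: fm | exact: gm].
by rewrite -big_split; apply: eq_bigr => k _; rewrite mulrDl.
Qed.

Let hspanZ m a x : hspan m x -> hspan m (a *: x).
Proof.
elim: m => [|m IHm] in x *.
  by move=> [b ->]; exists (a * b); rewrite scalerA.
move=> [f [fm ->]]; exists (fun k => a *: f k); split.
  by move=> k; apply: IHm; exact: fm.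
by rewrite scaler_sumr; apply: eq_bigr => k _; rewrite scalerAl.
Qed.

Let hspan_sum m (I : finType) (F : I -> H) :
  (forall i, hspan m (F i)) -> hspan m (\sum_i F i).
Proof. by move=> Fm; apply: big_ind => //; apply: hspanD. Qed.

Let hspanM m x k : (k <= m.+1)%N -> hspan m x -> hspan m.+1 (x * D m k).
Proof.
move=> km xm; exists (fun i => if i == k :> nat then x else 0); split.
  by move=> i; case: ifP.
rewrite (bigD1 (Ordinal (km : k < m.+2)%N)) //= eqxx big1 ?addr0 // => i.
by rewrite -val_eqE /= => /negbTE ->; rewrite mul0r.
Qed.

Let hspan1 m : hspan m 1.
Proof.
elim: m => [|m IHm]; first by exists 1; rewrite scale1r.
by rewrite -(D1 m) -[D _ _]mul1r; apply: hspanM.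
Qed.

Let hspan_mulT m j x : (j < m)%N -> (m <= n.-1)%N -> hspan m x -> hspan m (x * t j).
Proof.
elim: m => // m IHm in j x * => jm mn [f [fm ->]].
rewrite mulr_suml; apply: hspan_sum => k; rewrite -mulrA.
have kj := ltn_ord k; have [jk|kj'] := ltnP j.+1 k.
  rewrite D_far // mulrA; apply: hspanM => //.
  apply: IHm; [| exact: ltnW | exact: fm].
  by rewrite -ltnS (leq_trans jk).
have [{}jk|jk] := eqVneq (k : nat) j.+1.
  by rewrite jk -DS //; apply: hspanM; [apply: ltnW | exact: fm].
have {}kj' : (k <= j)%N by rewrite -ltnS ltn_neqAle jk.
have [{}jk|{}jk] := eqVneq (k : nat) j.
  have fk := fm k; rewrite jk DS // -mulrA t_quad; last exact: leq_trans mn.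
  rewrite mulrDr -scalerAr -DS // mulrDr; apply: hspanD.
    by rewrite -scalerAr; apply: hspanZ; apply: hspanM; [apply: ltnW |].
  by rewrite mulr_algr -scalerAr; apply: hspanZ; apply: hspanM.
case: j => [|j] in jm kj' jk *; first by rewrite leqn0 (negbTE jk) in kj'.
have {}kj' : (k <= j)%N by rewrite -ltnS ltn_neqAle jk.
rewrite D_shift // mulrA; apply: hspanM => //.
by apply: IHm; [| apply: ltnW | exact: fm].
Qed.

Let hspan_full x : hspan n.-1 x.
Proof.
suff h y z : hspan n.-1 y -> hspan n.-1 (y * z) by rewrite -[x]mul1r; apply: h.
elim/hecke_ind: z y => [a|i|u v IHu IHv|u v IHu IHv] y ym.
- by rewrite mulr_algr; apply: hspanZ.
- have -> : heckeT q i = t i by rewrite (tE (ltn_ord i)); congr heckeT; apply: val_inj.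
  exact: hspan_mulT.
- by rewrite mulrDr; apply: hspanD; [apply: IHu | apply: IHv].
- by rewrite mulrA; apply: IHv; apply: IHu.
Qed.

Let hspan_fin m : exists (I : finType) (b : I -> H), forall x, hspan m x ->
  exists c : I -> K, x = \sum_i c i *: b i.
Proof.
elim: m => [|m [I [b IHm]]].
  exists unit, (fun _ => 1) => x [a ->]; exists (fun _ => a).
  by rewrite (big_pred1 tt) // => -[].
exists ('I_m.+2 * I)%type, (fun p : 'I_m.+2 * I => b p.2 * D m p.1) => x [f [fm ->]].
have [c cE] := boolp.choice (fun k => IHm _ (fm k)).
exists (fun p : 'I_m.+2 * I => c p.1 p.2).
rewrite -(pair_bigA _ (fun k i => c k i *: (b i * D m k))) /=.
apply: eq_bigr => k _; rewrite [in LHS]cE mulr_suml.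
by apply: eq_bigr => i _; rewrite scalerAl.
Qed.

Lemma hecke_findim : {d : nat & Vector.axiom d H}.
Proof.
have [I /cid [b bP]] := cid (hspan_fin n.-1).
apply: (@spans_findim K H #|I| (fun i => b (enum_val i))) => v.
have [c ->] := bP v (hspan_full v); exists (fun i => c (enum_val i)).
by rewrite -(big_enum_val (fun i => c i *: b i)).
Qed.

HB.instance Definition _ := Lmodule_hasFinDim.Build K H (projT2 hecke_findim).
HB.instance Definition _ := Algebra_isFalgebra.Build K H.

End FiniteDimension.

(* With 0-based indices, the summand at i is T_{s_{n-1}} ... T_{s_{i+1}} in    *)
(* [heckeB] and T_{s_{i+1}} ... T_{s_{n-1}} in [heckeBstar]; it is 1 when      *)
(* i = n - 1.                                                                  *)
Definition heckeB (K : fieldType) (n : nat) (q : K) : hecke n q :=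
  \sum_(i < n) \prod_(k <- rev (enum 'I_n.-1) | (i <= k)%N) heckeT q k.

Definition heckeBstar (K : fieldType) (n : nat) (q : K) : hecke n q :=
  \sum_(j < n) \prod_(k < n.-1 | (j <= k)%N) heckeT q k.

Definition qint (K : fieldType) (q : K) (m : nat) : K := \sum_(i < m) q ^+ i.

Definition derangements (j : nat) : nat :=
  #|[set s : 'S_j | [forall i, s i != i]]|.

Definition heckeP (K : fieldType) (n : nat) (q : K) : {poly K} :=
  \prod_(j < n.+1 | (j : nat) != 1%N) ('X - (qint q (n - j))%:P).

Definition heckeChi (K : fieldType) (n : nat) (q : K) : {poly K} :=
  \prod_(j < n.+1) ('X - (qint q (n - j))%:P) ^+ ('C(n, j) * derangements j).

Definition left_ideal (K : fieldType) (A : falgType K) (I : {vspace A}) : Prop :=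
  forall a x : A, x \in I -> a * x \in I.

(* Semisimplicity of A as a ring: the regular left module is completely        *)
(* reducible.                                                                  *)
Definition semisimple_alg (K : fieldType) (A : falgType K) : Prop :=
  forall I : {vspace A}, left_ideal I ->
    exists J : {vspace A},
      [/\ left_ideal J, (I + J)%VS = fullv & (I :&: J)%VS = 0%VS].

(* Matrix of an endomorphism in the library's chosen basis; its characteristic *)
(* polynomial and diagonalizability do not depend on that choice.              *)
Definition endmx (K : fieldType) (V : vectType K) (f : 'End(V)) :
  'M[K]_(\dim {:V}) := passmx.mxof (vbasis {:V}) (vbasis {:V}) f.

(* Main.v *)
From HB Require Import structures.
Require Import Defs.
From mathcomp Require Import all_boot all_order all_fingroup all_algebra all_field.
From mathcomp Require Import reals.
From mathcomp.real_closed Require Import complex.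
From mathcomp Require Import zify ring.

Set Implicit Arguments.
Unset Strict Implicit.
Unset Printing Implicit Defensive.

Import GRing.Theory Num.Theory.
Local Open Scope ring_scope.

(* From B_{m+1} = 1 + T_m B_m and the braid relations,
   T_m B_m B_{m+1} = q B_m B_{m+1}.  Hence the products
   C_a = B_{n-a+1} ... B_n are left eigenvectors of T_{n-a+1}, ..., T_{n-1} for
   the eigenvalue q, which gives B_n C_a = [a]_q C_a + q^a C_{a+1}.  Therefore
   the product of the B_n - [i]_q for i < a is a power of q times C_a, and
   C_n = C_{n-1} together with C_{n+1} = 0 yields the annihilating polynomial.
   The results for B*_n follow by passing to the opposite ring.

   For the multiplicities, right multiplication is written as a matrix over
   K[X], where X stands for q, on a basis indexed by the symmetric group.  Its
   characteristic polynomial divides a power of the annihilating polynomial, so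
   it is a product of factors y - [m]_X, and the multiplicities can be read off
   at X = 1.  There C_a has trace n!, so the multiplicities c_m satisfy
   sum_m c_m m(m-1)...(m-a+1) = n! for all a <= n; this triangular system is
   solved by c_m = C(n,m) d_{n-m}, by counting permutations by their moved
   points.

   If the algebra is semisimple then no [m]_q with 1 <= m <= n vanishes:
   otherwise C_n would be a nonzero element of square zero spanning a left ideal.
   If moreover n >= 3 then q <> 0, as H_n(0) has a nonsplit extension of two
   characters.  So the annihilating polynomial has simple roots. *)

(* The generators are indexed from 0, so that [t k] stands for T_{s_{k+1}}. *)
Record hecke_family (A : pzRingType) (q : A) (N : nat) (t : nat -> A) : Prop :=
  HeckeFamily {
    hf_central : forall x, q * x = x * q;
    hf_quad : forall k, (k < N)%N -> t k * t k = (q - 1) * t k + q;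
    hf_comm : forall i j, (i.+1 < j)%N -> (j < N)%N -> t i * t j = t j * t i;
    hf_braid : forall i, (i.+1 < N)%N ->
      t i * (t i.+1 * t i) = t i.+1 * (t i * t i.+1) }.

(** The relations are stable under reversing products, once the central q - 1 is moved across in the
    quadratic one. Statements about B_m thus transfer to B*_m. *)
Lemma hecke_family_conv (A : pzRingType) (q : A) N t :
  hecke_family q N t -> @hecke_family A^c q N t.
Proof.
case=> qC tq tC tB; split=> [x|k kN|i j ij jN|i iN].
- exact: esym (qC x).
- apply: etrans (tq k kN) _; congr (_ + _).
  change ((q - 1) * t k = t k * (q - 1)).
  by rewrite mulrBl mulrBr qC mul1r mulr1.
- exact: esym (tC i j ij jN).
- change (t i * t i.+1 * t i = t i.+1 * t i * t i.+1).
  by rewrite -!mulrA tB.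
Qed.

(** * The elements B_m, their products and the annihilating polynomial *)

Section Shuffle.
Variables (A : pzRingType) (t : nat -> A).

(* [shuffle m] is B_m; starting from B_0 = 0 gives B_1 = 1 whatever [t 0] is. *)
Fixpoint shuffle (m : nat) : A :=
  if m is m'.+1 then 1 + t m'.-1 * shuffle m' else 0.

(* [shuffle_prod n a] is B_{n-a+1} ... B_n, the sum of the T_w over the minimal
   representatives w of the right cosets of S_{n-a} in S_n. *)
Fixpoint shuffle_prod (n a : nat) : A :=
  if a is a'.+1 then shuffle (n - a') * shuffle_prod n a' else 1.

End Shuffle.

Section ShuffleTheory.
Variables (A : pzRingType) (q : A) (N : nat) (t : nat -> A).
Hypothesis tP : hecke_family q N t.
Local Notation b := (shuffle t).
Local Notation c := (shuffle_prod t).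

Let qC := hf_central tP.

(** B_m is built from generators of index at most m - 2, all at distance at least 2 from j. *)
Lemma shuffle_comm m j : (m <= j)%N -> (j < N)%N -> t j * b m = b m * t j.
Proof.
move=> + jN; elim: m => [|m IHm] mj /=; first by rewrite mul0r mulr0.
rewrite mulrDl mulrDr mul1r mulr1 -mulrA -IHm; last exact: ltnW.
case: m mj {IHm} => [|m] mj; first by rewrite /= !mulr0.
by rewrite [m.+1.-1]/= mulrA -(hf_comm tP mj jN) mulrA.
Qed.

Lemma hecke_quad1 j : (j < N)%N -> t j * (1 + t j) = q * (1 + t j).
Proof.
move=> jN; rewrite !mulrDr !mulr1 (hf_quad tP) // mulrBl mul1r.
by rewrite addrA [t j + _]addrC subrK addrC.
Qed.

Lemma shuffle_eigen m : (m <= N)%N ->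
  t m.-1 * (b m * b m.+1) = q * (b m * b m.+1).
Proof.
elim: m => [|m IHm] mN; first by rewrite /= !(mul0r, mulr0).
case: m mN IHm => [|m] mN IHm.
  by rewrite /= !(mulr0, addr0) mulr1 mul1r hecke_quad1.
have IH := IHm (ltnW mN); move: IH; rewrite [m.+1.-1]/= => IH.
set X := b m.+1 in IH *; set Y := b m.+2 in IH *.
have YE : Y = 1 + t m * X by [].
have -> : b m.+3 = 1 + t m.+1 * Y by [].
(* Only the left [Y] is expanded, and [X] commutes with [t m.+1]. The first term is an eigenvector
   by the quadratic relation; in the second, the braid relation exposes [t m * (X * Y)], to which
   the induction hypothesis applies. *)
have -> : Y * (1 + t m.+1 * Y) = (1 + t m.+1) * Y + t m * (t m.+1 * (X * Y)).
  rewrite mulrDr mulr1 [Y in Y * (_ * _)]YE mulrDl mul1r -!mulrA.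
  by rewrite [X * (_ * _)]mulrA -shuffle_comm // mulrDl mul1r addrA -!mulrA.
rewrite [m.+2.-1]/= mulrDr mulrA hecke_quad1 // [RHS]mulrDr -!mulrA; congr (_ + _).
transitivity (t m * (t m.+1 * (t m * (X * Y)))).
  have /(congr1 (fun z => z * (X * Y))) /= := hf_braid tP mN.
  by rewrite -!mulrA => ->.
by rewrite IH [t m.+1 * (q * _)]mulrA -qC -!mulrA [t m * (q * _)]mulrA -qC -!mulrA.
Qed.

(** Induction on a: the new leftmost factor commutes with [t j], except for the smallest admissible
    j, where [shuffle_eigen] applies to the two leftmost factors. *)
Lemma shuffle_prod_eigen n a j : (n <= N.+1)%N -> (a <= n)%N ->
  (n - a <= j)%N -> (j.+1 < n)%N -> t j * c n a = q * c n a.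
Proof.
move=> nN; elim: a => [|a IHa] an naj jn.
  by move: naj; rewrite subn0 leqNgt (ltn_trans _ jn).
have jN : (j < N)%N by rewrite -ltnS (leq_trans jn).
have [{}naj|jna] := leqP (n - a) j.
  by rewrite /= mulrA shuffle_comm // -mulrA (IHa (ltnW an) naj jn) !mulrA qC.
have e : (n - a = j.+1)%N by lia.
case: a e an {naj jna IHa} => [|a] e an; first by rewrite subn0 in e; rewrite e ltnn in jn.
have e2 : (n - a = j.+2)%N by lia.
rewrite /= -/(shuffle_prod t n a) e e2.
by rewrite [b j.+1 * _]mulrA mulrA (shuffle_eigen jN) !mulrA.
Qed.

Definition qnum (m : nat) : A := \sum_(i < m) q ^+ i.

Lemma qnumS m : qnum m.+1 = 1 + q * qnum m.
Proof.
by rewrite /qnum big_ord_recl expr0 mulr_sumr; congr (_ + _); apply: eq_bigr => i _;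
  rewrite exprS.
Qed.

Lemma mulr_qX x i : x * q ^+ i = q ^+ i * x.
Proof.
by elim: i => [|i IHi]; rewrite ?mulr1 ?mul1r // exprS -!mulrA -IHi !mulrA qC.
Qed.

Lemma mulr_qnum x k : x * qnum k = qnum k * x.
Proof.
by rewrite /qnum mulr_sumr mulr_suml; apply: eq_bigr => i _; rewrite mulr_qX.
Qed.

Lemma shuffle_mul_prod n a : (n <= N.+1)%N -> (a <= n)%N ->
  b n * c n a = qnum a * c n a + q ^+ a * c n a.+1.
Proof.
move=> nN an.
(* Climb the recursion for B from index n - a, where the product is [c n a.+1] by definition, up to
   n. Each step multiplies by the eigenvalue q and adds one copy of [c n a]. *)
suff h k : (k <= a)%N ->
    b (n - a + k) * c n a = qnum k * c n a + q ^+ k * c n a.+1.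
  by rewrite -(h a) // subnK.
elim: k => [|k IHk] ka.
  by rewrite addn0 /qnum big_ord0 mul0r add0r expr0 mul1r.
rewrite addnS /= mulrDl mul1r -mulrA IHk 1?ltnW // qnumS mulrDl mul1r -addrA.
congr (_ + _).
have tcE : t (n - a + k).-1 * c n a.+1 = q * c n a.+1.
  case: (ltnP a n) => [lt_an|le_na]; first by apply: shuffle_prod_eigen; lia.
  (* For a = n the new factor is B_0 = 0. *)
  have na0 : (n - a = 0)%N by lia.
  have -> : c n a.+1 = 0 by rewrite /= na0 mul0r.
  by rewrite !mulr0.
rewrite mulrDr [t _ * (qnum k * _)]mulrA [t _ * (q ^+ k * _)]mulrA
  mulr_qnum mulr_qX -!mulrA tcE exprSr.
rewrite -!mulrA; congr (_ + _).
(* For k = 0 the index lies below the range of [shuffle_prod_eigen] for [c n a], but the coefficient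
   [0]_q vanishes. *)
have [->|kpos] := posnP k; first by rewrite /qnum big_ord0 !(mul0r, mulr0).
have -> : t (n - a + k).-1 * c n a = q * c n a by apply: shuffle_prod_eigen; lia.
by rewrite !mulrA mulr_qnum.
Qed.

(** The reversed list puts the newest factor on the left, where [shuffle_mul_prod] cancels [a]_q and
    leaves q^a times the next product. *)
Lemma prod_shuffle_sub n a : (n <= N.+1)%N -> (a <= n)%N ->
  \prod_(i <- rev (iota 0 a)) (b n - qnum i) =
  q ^+ (\sum_(i < a) i) * c n a.
Proof.
move=> nN; elim: a => [|a IHa] an; first by rewrite big_nil big_ord0 expr0 mul1r.
rewrite -addn1 iotaD rev_cat big_cat big_seq1 addn1 IHa ?(ltnW an) // add0n.
rewrite big_ord_recr /= addnC exprD.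
rewrite mulrA mulr_qX -mulrA mulrBl shuffle_mul_prod ?(ltnW an) // [qnum a * _ + _]addrC addrK.
by rewrite !mulrA -!exprD addnC.
Qed.

Lemma shuffle_annihilated n : (0 < n)%N -> (n <= N.+1)%N ->
  \prod_(i <- n :: rev (iota 0 n.-1)) (b n - qnum i) = 0.
Proof.
case: n => // n _ nN; rewrite big_cons prod_shuffle_sub //.
(* The last factor is B_1 = 1; this is why one q-integer is missing from the list of roots. *)
have cE : c n.+1 n.+1 = c n.+1 n by rewrite /= subSnn /= mulr0 addr0 mul1r.
have c0 : c n.+1 n.+2 = 0 by rewrite /= subnn /= mul0r.
rewrite mulrA mulr_qX -mulrA mulrBl -[n.+1.-1]/n -cE shuffle_mul_prod //.
by rewrite c0 mulr0 addr0 subrr mulr0.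
Qed.

End ShuffleTheory.

Lemma qnum_morph (K A : pzRingType) (f : {rmorphism K -> A}) (q : K) m :
  qnum (f q) m = f (qnum q m).
Proof. by rewrite /qnum rmorph_sum; apply: eq_bigr => i _; rewrite rmorphXn. Qed.

(** * The elements B*_m, through the opposite ring *)

Section StarShuffle.
Variables (A : pzRingType) (q : A) (N : nat) (t : nat -> A).
Hypothesis tP : hecke_family q N t.

Definition shuffle_star (m : nat) : A := @shuffle A^c t m.

Lemma shuffle_starS m : shuffle_star m.+1 = 1 + shuffle_star m * t m.-1.
Proof. by []. Qed.

Lemma shuffle_star_annihilated n : (0 < n)%N -> (n <= N.+1)%N ->
  \prod_(i <- rcons (iota 0 n.-1) n) (shuffle_star n - qnum q i) = 0.
Proof.
move=> n0 nN; have := shuffle_annihilated (hecke_family_conv tP) n0 nN.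
rewrite rev_prodr rev_cons revK => h; rewrite -[RHS]h.
apply: eq_bigr => i _; congr (_ - _).
elim: i => [|i IHi]; first by rewrite /qnum !big_ord0.
rewrite qnumS IHi (@qnumS A^c q i); congr (_ + _).
exact: (hf_central tP).
Qed.

End StarShuffle.

Lemma sum_delta (R : pzRingType) (I : finType) (a : I) (F : I -> R) :
  \sum_i (i == a)%:R * F i = F a.
Proof.
by rewrite (bigD1 a) //= eqxx mul1r big1 ?addr0 // => i /negbTE->; rewrite mul0r.
Qed.

(** * The regular representation over a commutative ring *)

Section RegularRepresentation.
Variable (n : nat).
Local Notation W := 'S_n.+1.
Implicit Types u v w : W.

(** Permutations compose from left to right, so this exchanges the values of u at positions k and k
    + 1. *)
Definition swap (k : nat) u : W := (tperm (inord k) (inord k.+1) * u)%g.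
Definition ascent (k : nat) u : bool := (u (inord k) < u (inord k.+1))%N.

Lemma inord_eq i j : (i <= n)%N -> (j <= n)%N ->
  ((inord i : 'I_n.+1) == inord j) = (i == j).
Proof. by move=> ni nj; rewrite -val_eqE /= !inordK. Qed.

Lemma swapL k u : swap k u (inord k) = u (inord k.+1).
Proof. by rewrite permM tpermL. Qed.

Lemma swapR k u : swap k u (inord k.+1) = u (inord k).
Proof. by rewrite permM tpermR. Qed.

Lemma swapD k u j : (k < n)%N -> (j <= n)%N -> j != k -> j != k.+1 ->
  swap k u (inord j) = u (inord j).
Proof.
by move=> kn jn jk jk1; rewrite permM tpermD // inord_eq // 1?eq_sym // ltnW.
Qed.

Lemma swapK k : involutive (swap k).
Proof. by move=> u; rewrite /swap mulgA tperm2 mul1g. Qed.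

Lemma perm_val_neq u i j : (i <= n)%N -> (j <= n)%N -> (i == j) = false ->
  (u (inord i) == u (inord j) :> nat) = false.
Proof. by move=> ni nj; rewrite val_eqE (inj_eq perm_inj) inord_eq. Qed.

Lemma ascent_swap k u : (k < n)%N -> ascent k (swap k u) = ~~ ascent k u.
Proof.
move=> kn; rewrite /ascent swapL swapR.
have := perm_val_neq u (ltnW kn) kn (ltn_eqF (leqnn k.+1)); lia.
Qed.

Variables (R : comNzRingType) (q : R).

(** Acting on row vectors from the right, this is right multiplication by a generator in the basis
    T_u: an ascent of u is an increase in length. *)
Definition regT (k : nat) : 'M[R]_#|W| :=
  \matrix_(i, j) let u := enum_val i in let v := enum_val j in
    (if ascent k u then 1 else q) * (v == swap k u)%:R +
    (if ascent k u then 0 else q - 1) * (v == u)%:R.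

Local Notation er := (@enum_rank W).

Lemma regT_mull k p (M : 'M_(_, p)) u j :
  (regT k *m M) (er u) j =
  (if ascent k u then 1 else q) * M (er (swap k u)) j +
  (if ascent k u then 0 else q - 1) * M (er u) j.
Proof.
rewrite mxE (eq_bigr (fun i =>
   (if ascent k u then 1 else q) * ((i == er (swap k u))%:R * M i j) +
   (if ascent k u then 0 else q - 1) * ((i == er u)%:R * M i j))); last first.
  move=> i _; rewrite mxE !enum_rankK mulrDl -!mulrA.
  by rewrite -!(can2_eq (@enum_valK W) (@enum_rankK W)).
by rewrite big_split -!mulr_sumr !sum_delta.
Qed.

Lemma regT_mulr k p (M : 'M_(p, _)) i w : (k < n)%N ->
  (M *m regT k) i (er w) =
  (if ascent k w then q else 1) * M i (er (swap k w)) +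
  (if ascent k w then 0 else q - 1) * M i (er w).
Proof.
move=> kn; rewrite mxE (eq_bigr (fun j =>
   (if ascent k w then q else 1) * ((j == er (swap k w))%:R * M i j) +
   (if ascent k w then 0 else q - 1) * ((j == er w)%:R * M i j))); last first.
  move=> j _; rewrite mxE enum_rankK -!(can2_eq (@enum_valK W) (@enum_rankK W)).
  rewrite /= [w == enum_val j]eq_sym -(can2_eq (@swapK k) (@swapK k)) [swap k w == _]eq_sym.
  have [->|_] := eqVneq (enum_val j) (swap k w).
    rewrite ascent_swap // if_neg.
    have /negbTE-> : swap k w != w.
      by apply/eqP => e; have := ascent_swap w kn; rewrite e; case: (ascent k w).
    by rewrite mulr0 addr0 !mul0r mulr0 addr0 mul1r mulr1 mulrC.
  have [->|_] := eqVneq (enum_val j) w; last by rewrite !(mul0r, mulr0, addr0).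
  by rewrite !(mul0r, mulr0, add0r, mul1r, mulr1) mulrC.
by rewrite big_split -!mulr_sumr !sum_delta.
Qed.

Lemma regular_hecke_family : hecke_family (A := 'M[R]_#|W|) (q%:M) n regT.
Proof.
have ext (M M' : 'M[R]_#|W|) : (forall u j, M (er u) j = M' (er u) j) -> M = M'.
  by move=> h; apply/matrixP => x j; rewrite -[x]enum_valK h.
split=> [M|k kn|i j ij jn|i iN].
- exact/esym/scalar_mxC.
- apply: ext => u j.
  (* The trailing identity matrix lets [regT_mull] expand every factor. *)
  have -> : regT k * regT k = regT k *m (regT k *m 1%:M) by rewrite mulmx1.
  have -> : ((q%:M - 1) * regT k + q%:M) (er u) j =
     (q - 1) * (regT k *m 1%:M) (er u) j + q * (1%:M : 'M[R]_#|W|) (er u) j.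
    have -> : q%:M - 1 = (q - 1)%:M :> 'M[R]_#|W| by rewrite raddfB.
    by rewrite mulmx1 [_ * _]mul_scalar_mx -[in q%:M]scalemx1 !mxE.
  rewrite !regT_mull swapK ascent_swap //; case: (ascent k u) => /=; ring.
- apply: ext => u p.
  have sw : swap i (swap j u) = swap j (swap i u).
    rewrite /swap !mulgA; congr (_ * u)%g; rewrite [RHS]conjgC tpermJ.
    by congr (_ * _)%g; rewrite !tpermD // inord_eq; lia.
  have ai : ascent i (swap j u) = ascent i u by rewrite /ascent !swapD //; lia.
  have aj : ascent j (swap i u) = ascent j u by rewrite /ascent !swapD //; lia.
  have -> : regT i * regT j = regT i *m (regT j *m 1%:M) by rewrite mulmx1.
  have -> : regT j * regT i = regT j *m (regT i *m 1%:M) by rewrite mulmx1.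
  by rewrite !regT_mull sw ai aj; ring.
- apply: ext => u p.
  have -> : regT i * (regT i.+1 * regT i) = regT i *m (regT i.+1 *m (regT i *m 1%:M)).
    by rewrite mulmx1.
  have -> : regT i.+1 * (regT i * regT i.+1) = regT i.+1 *m (regT i *m (regT i.+1 *m 1%:M)).
    by rewrite mulmx1.
  have sw : swap i (swap i.+1 (swap i u)) = swap i.+1 (swap i (swap i.+1 u)).
    rewrite /swap !mulgA; congr (_ * u)%g; symmetry.
    have cj x y (s : W) : (tperm x y * s * tperm x y = s ^ tperm x y)%g.
      by rewrite conjgE tpermV mulgA.
    rewrite !cj !tpermJ.
    by rewrite tpermL tpermR !tpermD // inord_eq; lia.
  rewrite !regT_mull !swapK sw.
  have xy := perm_val_neq u (ltnW (ltnW iN)) (ltnW iN) (ltn_eqF (leqnn i.+1)).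
  have yz := perm_val_neq u (ltnW iN) iN (ltn_eqF (leqnn i.+2)).
  have xz := perm_val_neq u (ltnW (ltnW iN)) iN (ltn_eqF (leqnSn i.+1)).
  have s1 v : swap i v (inord i.+2) = v (inord i.+2) by apply: swapD; lia.
  have s2 v : swap i.+1 v (inord i) = v (inord i) by apply: swapD; lia.
  (* All ascents now depend only on the relative order of the three values of u at i, i + 1, i + 2;
     each of the six orders leaves a polynomial identity in q. *)
  rewrite /ascent !(swapL, swapR, s1, s2).
  move: xy yz xz; set x : nat := u (inord i); set y : nat := u (inord i.+1).
  set z : nat := u (inord i.+2).
  case: (ltngtP x y) => //; case: (ltngtP y z) => //; case: (ltngtP x z) => //.
  all: by intros; try ring; lia.
Qed.
End RegularRepresentation.

Lemma map_regT (R S : comNzRingType) (f : {rmorphism R -> S}) n (q : R) k :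
  map_mx f (regT n q k) = regT n (f q) k.
Proof.
apply/matrixP => i j; rewrite !mxE rmorphD !rmorphM !rmorph_nat.
by rewrite !(fun_if f) rmorphB rmorph1 rmorph0.
Qed.

(** * Supports of row vectors, and cyclicity of the identity vector *)

Section Support.
Variables (n : nat) (R : comNzRingType) (q : R).
Local Notation W := 'S_n.+1.
Implicit Types u v w : W.
Local Notation er := (@enum_rank W).
Local Notation T := (regT n q).
Local Notation B := (@shuffle 'M[R]_#|W| T).

Definition fixes_from m u := forall j, (m <= j <= n)%N -> u (inord j) = inord j.

Lemma fixes_fromW m u : fixes_from m u -> fixes_from m.+1 u.
Proof. by move=> fu j /andP[mj jn]; apply: fu; rewrite jn ltnW. Qed.

Lemma fixes_from_val m u j : fixes_from m.+1 u -> (j <= m)%N -> (m <= n)%N ->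
  (u (inord j) <= m)%N.
Proof.
move=> fu jm mn; rewrite leqNgt; apply/negP => mu.
have := fu (u (inord j)); rewrite mu -ltnS ltn_ord inord_val => /(_ isT) /perm_inj e.
have := congr1 (@nat_of_ord _) e; rewrite inordK; lia.
Qed.

Definition moves_to k m u := u (inord k) = inord m /\ fixes_from m.+1 u.

(** On the support, m is the largest value at positions up to m, and each generator in turn moves it
    one position to the left. After one move the identity is outside the support, so only the
    summand 1 of B contributes to its coefficient. *)
Lemma shuffle_support k m (x : 'rV_#|W|) : (k <= m)%N -> (m <= n)%N ->
    (forall u, x 0 (er u) != 0 -> moves_to k m u) ->
  (forall u, (x *m B k.+1) 0 (er u) != 0 -> fixes_from m.+1 u) /\
  (x *m B k.+1) 0 (er 1%g) = x 0 (er 1%g).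
Proof.
elim: k x => [|k IHk] x km mn supp.
  rewrite /= mulr0 addr0 [1]/(1%:M) mulmx1.
  by split=> // u /supp[].
have kn : (k < n)%N by lia.
have supp' u : (x *m T k) 0 (er u) != 0 -> moves_to k m u.
  rewrite regT_mulr // => nz.
  have [z|{}nz] := eqVneq (x 0 (er (swap k u))) 0; last first.
    have [e fu] := supp _ nz; rewrite swapR in e; split=> // j mj.
    by have := fu j mj; rewrite swapD //; lia.
  case: ifP nz => [_|asc]; first by rewrite z mulr0 mul0r addr0 eqxx.
  have [z'|{}nz _] := eqVneq (x 0 (er u)) 0; first by rewrite z z' !mulr0 addr0 eqxx.
  have [e fu] := supp _ nz.
  have := fixes_from_val fu (ltnW km) mn.
  have := perm_val_neq u (ltnW kn) kn (ltn_eqF (leqnn k.+1)).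
  by move: asc; rewrite /ascent e inordK //; lia.
have [s1 s2] := IHk _ (ltnW km) mn supp'.
have -> : x *m B k.+2 = x + x *m T k *m B k.+1.
  by rewrite -[B k.+2]/(1%:M + T k *m B k.+1) mulmxDr mulmx1 mulmxA.
split=> [u|].
  rewrite mxE; have [z|nz _] := eqVneq (x 0 (er u)) 0.
    by rewrite z add0r; apply: s1.
  by have [] := supp _ nz.
rewrite mxE s2; have [->|/supp'[+ _]] := eqVneq ((x *m T k) 0 (er 1%g)) 0.
  by rewrite addr0.
by rewrite perm1 => /eqP; rewrite inord_eq //; lia.
Qed.

(** Factor by factor, the support grows from one parabolic subgroup to the next while the
    coefficient at the identity is preserved. This yields the traces at q = 1 and the nonvanishing
    of C_n. *)
Lemma shuffle_prod_coef1 a : (a <= n.+1)%N ->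
  shuffle_prod (T : nat -> 'M_#|W|) n.+1 a (er 1%g) (er 1%g) = 1.
Proof.
move=> an; set c := shuffle_prod _ _.
suff h (x : 'rV_#|W|) : (forall u, x 0 (er u) != 0 -> fixes_from (n.+1 - a) u) ->
    (x *m c a) 0 (er 1%g) = x 0 (er 1%g).
  have := h (delta_mx 0 (er 1%g)); rewrite -rowE !mxE !eqxx; apply=> u.
  rewrite mxE (inj_eq enum_rank_inj) /=; have [->|_] := eqVneq u 1%g; last by rewrite eqxx.
  by move=> _ j _; rewrite perm1.
elim: a an x => [|a IHa] an x supp; first by rewrite [c 0%N]/(1%:M) mulmx1.
have -> : x *m c a.+1 = x *m B (n.+1 - a) *m c a by rewrite -mulmxA.
have e : (n.+1 - a = (n.+1 - a.+1).+1)%N by lia.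
have nn : (n.+1 - a.+1 <= n)%N by lia.
have [|s1 s2] := @shuffle_support (n.+1 - a.+1) (n.+1 - a.+1) x (leqnn _) nn.
  move=> u /supp fu; split; last exact: fixes_fromW.
  by apply: fu; rewrite leqnn.
rewrite -s2 e IHa //; first exact: ltnW.
by rewrite e.
Qed.

(** Sort u by adjacent exchanges: if the value m sits at k < m, then k is a descent and the basis
    vector of u is the image under [T k] of that of [swap k u], where m is one step closer to its
    place. *)
Lemma regular_cyclic (S : 'rV[R]_#|W| -> Prop) :
    S (delta_mx 0 (er 1%g)) -> (forall k x, (k < n)%N -> S x -> S (x *m T k)) ->
  forall u, S (delta_mx 0 (er u)).
Proof.
move=> S1 ST.
suff h m u : (m <= n.+1)%N -> fixes_from m u -> S (delta_mx 0 (er u)).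
  by move=> u; apply: (h n.+1) => // j; lia.
elim: m u => [|m IHm] u mn fu.
  suff -> : u = 1%g by [].
  by apply/permP => j; rewrite perm1 -[j]inord_val fu //; have := ltn_ord j; lia.
pose k := (u^-1)%g (inord m) : 'I_n.+1.
have [e] := ubnP (m - k); elim: e => // e IHe in u fu k *; move=> mke.
have kn1 := ltn_ord k.
have uk : u (inord k) = inord m by rewrite inord_val permKV.
have km : (k <= m)%N.
  rewrite leqNgt; apply/negP => mk; have := fu k; rewrite mk -ltnS ltn_ord uk.
  by move=> /(_ isT) /eqP; rewrite inord_eq; lia.
have [{}km|ne] := eqVneq (k : nat) m.
  apply: (IHm u (ltnW mn)) => j /andP[mj jn].
  have [->|jm] := eqVneq j m; first by rewrite -{1}km uk.
  by apply: fu; lia.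
have kn : (k < n)%N by lia.
have nasc : ascent k u = false.
  have : (u (inord k.+1) <= m)%N by apply: fixes_from_val => //; lia.
  by rewrite /ascent uk inordK //; lia.
have -> : delta_mx 0 (er u) = delta_mx 0 (er (swap k u)) *m T k :> 'rV_#|W|.
  apply/rowP => j; rewrite -[j]enum_valK regT_mulr // !mxE !(inj_eq enum_rank_inj) !eqxx /=.
  rewrite (inj_eq (can_inj (@swapK n k))).
  have [->|_] := eqVneq (enum_val j) u.
    rewrite nasc; have /negbTE-> : u != swap k u.
      by apply/eqP => e'; have := ascent_swap u kn; rewrite -e' nasc.
    by rewrite mulr1 mulr0 addr0.
  have [->|_] := eqVneq (enum_val j) (swap k u); last by rewrite !mulr0 addr0.
  by rewrite ascent_swap // nasc mulr0 mul0r addr0.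
apply: ST => //.
have sk : ((swap k u)^-1)%g (inord m) = inord k.+1 :> 'I_n.+1.
  by apply: (@perm_inj _ (swap k u)); rewrite permKV swapR uk.
apply: IHe; last by rewrite sk inordK; lia.
by move=> j mj; rewrite swapD ?fu //; lia.
Qed.

End Support.

(** * Traces at q = 1 *)

Section GroupCase.
Variables (n : nat) (R : comNzRingType).
Local Notation W := 'S_n.+1.
Local Notation er := (@enum_rank W).

(** The translation by g relabels values, whereas [swap] acts on positions; at q = 1 the two
    commute. *)
Definition left_invariant (M : 'M[R]_#|W|) :=
  forall u w g : W, M (er (u * g)%g) (er (w * g)%g) = M (er u) (er w).

Lemma left_invariantD M M' :
  left_invariant M -> left_invariant M' -> left_invariant (M + M').
Proof. by move=> iM iM' u w g; rewrite !mxE iM iM'. Qed.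

Lemma left_invariantM M M' :
  left_invariant M -> left_invariant M' -> left_invariant (M *m M').
Proof.
move=> iM iM' u w g; rewrite !mxE.
rewrite (reindex (fun j : 'I_#|W| => er ((enum_val j : W) * g)%g)) /=.
  by apply: eq_bigr => j _; rewrite iM iM' enum_valK.
exists (fun j : 'I_#|W| => er ((enum_val j : W) * g^-1)%g) => j _.
  by rewrite enum_rankK mulgK enum_valK.
by rewrite enum_rankK mulgKV enum_valK.
Qed.

Lemma left_invariant0 : left_invariant 0.
Proof. by move=> u w g; rewrite !mxE. Qed.

Lemma left_invariant1 : left_invariant 1%:M.
Proof. by move=> u w g; rewrite !mxE !(inj_eq enum_rank_inj) (inj_eq (mulIg g)). Qed.

Lemma left_invariant_regT k : left_invariant (regT n 1 k).
Proof.
move=> u w g; rewrite !mxE !enum_rankK /= !if_same subrr !if_same !mul0r !addr0.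
by rewrite {1}/swap mulgA (inj_eq (mulIg g)).
Qed.

Lemma left_invariant_shuffle m :
  left_invariant (shuffle (regT n 1 : nat -> 'M[R]_#|W|) m).
Proof.
elim: m => [|m IHm]; first exact: left_invariant0.
apply: left_invariantD; first exact: left_invariant1.
by apply: left_invariantM => //; apply: left_invariant_regT.
Qed.

(** By invariance all diagonal entries equal the one at the identity, which is 1. *)
Lemma mxtrace_shuffle_prod a : (a <= n.+1)%N ->
  \tr (shuffle_prod (regT n 1 : nat -> 'M[R]_#|W|) n.+1 a) = #|W|%:R.
Proof.
move=> an; set M := shuffle_prod _ _ _.
have iM : left_invariant M.
  rewrite {}/M; elim: a an => [|a IHa] an; first exact: left_invariant1.
  by apply: left_invariantM; [exact: left_invariant_shuffle | apply: IHa; apply: ltnW].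
rewrite /mxtrace (eq_bigr (fun _ => 1)); first by rewrite sumr_const card_ord.
move=> x _; rewrite -[x]enum_valK -[enum_val x]mul1g iM.
exact: shuffle_prod_coef1.
Qed.

End GroupCase.

(** * Derangement numbers and the triangular system for the multiplicities *)

Definition moved (T : finType) (s : {perm T}) : {set T} := [set x | s x != x].
Definition perms_moving (T : finType) (A : {set T}) : nat :=
  #|[set s : {perm T} | moved s == A]|.

Lemma sum_perms_moving (T : finType) (A : {set T}) :
  (\sum_(B : {set T} | B \subset A) perms_moving B = #|A|`!)%N.
Proof.
rewrite -card_perm -sum1_card.
rewrite (partition_big (@moved T) (fun B => B \subset A)); last first.
  move=> s sA; apply/subsetP => x; rewrite inE; exact: (subsetP sA).
apply: eq_bigr => B BA; rewrite sum1dep_card /perms_moving; apply: eq_card => s.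
rewrite !inE; case: eqP => [sB|]; last by rewrite andbF.
rewrite andbT; apply/esym/subsetP => x sx; apply: (subsetP BA).
by rewrite -sB inE.
Qed.

Lemma sum_subset_card (T : finType) (A : {set T}) (F : nat -> nat) :
  (\sum_(B : {set T} | B \subset A) F #|B| = \sum_(j < #|A|.+1) 'C(#|A|, j) * F j)%N.
Proof.
rewrite (partition_big (fun B : {set T} => inord #|B| : 'I_#|A|.+1) xpredT) //=.
apply: eq_bigr => j _; rewrite -cards_draws -sum_nat_const.
apply: eq_big => [B|B /andP[BA /eqP <-]].
  rewrite inE; case: (boolP (B \subset A)) => //= BA.
  by rewrite -val_eqE /= inordK // ltnS subset_leq_card.
by rewrite inordK // ltnS subset_leq_card.
Qed.

(** [sum_perms_moving] is a recursion that determines the count from cardinalities alone. *)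
Lemma perms_moving_card (T U : finType) (A : {set T}) (B : {set U}) :
  #|A| = #|B| -> perms_moving A = perms_moving B.
Proof.
have [e] := ubnP #|A|; elim: e T U A B => // e IHe T U A B Ae AB.
pose F j := perms_moving [set: 'I_j].
(* Proper subsets contribute equally on both sides by induction; the added terms avoid a subtraction
   of natural numbers. *)
have sumE (V : finType) (C : {set V}) : #|C| = #|A| ->
    (perms_moving C + \sum_(j < #|A|.+1) 'C(#|A|, j) * F j = #|A|`! + F #|A|)%N.
  move=> CA; rewrite -CA -sum_subset_card -sum_perms_moving.
  rewrite (bigD1 C) //= [X in _ = X + _](bigD1 C) //= -[RHS]addnA.
  congr (_ + _)%N; rewrite addnC; congr (_ + _)%N.
  apply: eq_bigr => D /andP[DC neq].
  have DltC : (#|D| < #|C|)%N by apply: proper_card; rewrite properEneq neq.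
  by apply/esym/IHe; [lia | rewrite cardsT card_ord].
by apply/eqP; rewrite -(eqn_add2r (\sum_(j < #|A|.+1) 'C(#|A|, j) * F j)) !sumE.
Qed.

Lemma perms_movingE (T : finType) (A : {set T}) : perms_moving A = derangements #|A|.
Proof.
rewrite (@perms_moving_card _ 'I_#|A| _ setT) ?cardsT ?card_ord //.
apply: eq_card => s; rewrite !inE; apply/eqP/forallP => [h i|h].
  by have := in_setT i; rewrite -h inE.
by apply/setP => i; rewrite !inE h.
Qed.

Lemma sum_derangements N : (\sum_(j < N.+1) 'C(N, j) * derangements j = N`!)%N.
Proof.
have := sum_perms_moving [set: 'I_N].
rewrite (eq_bigr _ (fun B _ => perms_movingE B)) (sum_subset_card _ derangements).
by rewrite cardsT card_ord.
Qed.

(** The identity C(n, m) m^_a = n^_a C(n - a, n - m) pulls n^_a out of the sum and leaves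
    [sum_derangements] for n - a. Terms with m < a vanish. *)
Lemma sum_derangements_ffact n a : (a <= n)%N ->
  (\sum_(m < n.+1) 'C(n, m) * derangements (n - m) * m ^_ a = n`!)%N.
Proof.
move=> an; rewrite -(ffact_fact an) -sum_derangements big_distrr /=.
rewrite -(big_mkord xpredT (fun m => 'C(n, m) * derangements (n - m) * m ^_ a)%N).
rewrite (big_cat_nat (n := a)) //=; last exact: leqW.
rewrite big_nat big1 ?add0n => [|i /andP[_ ia]]; last by rewrite ffact_small ?muln0.
rewrite -{1}[a]add0n big_addn subSn // big_mkord.
rewrite (reindex_inj rev_ord_inj) /=; apply: eq_bigr => i _.
have ina : (i <= n - a)%N by rewrite -ltnS.
rewrite subSS (_ : n - a - i + a = n - i)%N; last by lia.
rewrite subKn; last by lia.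
rewrite mulnAC mulnA; congr (_ * _)%N.
(* After multiplication by these two factorials both sides equal n!. *)
apply/eqP; rewrite -(eqn_pmul2r (fact_gt0 (n - a - i))) -(eqn_pmul2r (fact_gt0 i)).
have e1 : ('C(n, n - i) * (i`! * (n - i)`!) = n`!)%N.
  by rewrite bin_sub ?bin_fact //; lia.
have e2 : ((n - i) ^_ a * (n - a - i)`! = (n - i)`!)%N.
  by rewrite subnAC; apply: ffact_fact; lia.
have e3 : ('C(n - a, i) * (i`! * (n - a - i)`!) = (n - a)`!)%N by rewrite bin_fact.
have e4 := ffact_fact an.
apply/eqP; transitivity n`!; [rewrite -e1 -e2 | rewrite -e4 -e3]; ring.
Qed.

(** Since m^_a = 0 for m < a, the system is triangular with pivots m!; it is solved downward from m
    = n. *)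
Lemma ffact_moments_inj n (c d : nat -> nat) :
    (forall a, (a <= n)%N ->
       \sum_(m < n.+1) c m * m ^_ a = \sum_(m < n.+1) d m * m ^_ a)%N ->
  forall m, (m <= n)%N -> c m = d m.
Proof.
move=> h m mn; have [e] := ubnP (n - m); elim: e => // e IHe in m mn *; move=> nme.
pose o := Ordinal (mn : m < n.+1)%N.
have := h m mn; rewrite (bigD1 o) //= [RHS](bigD1 o) //=.
rewrite [X in (_ + X)%N](eq_bigr (fun i : 'I_n.+1 => d i * i ^_ m)%N).
  by move=> /addIn /eqP; rewrite eqn_pmul2r ?ffact_gt0 // => /eqP.
move=> i; rewrite -val_eqE /= => im.
have [ltim|leim] := ltnP i m; first by rewrite ffact_small // !muln0.
have := ltn_ord i; rewrite ltnS => lein.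
by rewrite IHe //; lia.
Qed.

(** * Linear algebra: split characteristic polynomials and diagonalization *)

Section SplitCharPoly.
Variables (R : comNzRingType) (N : nat).
Local Notation M := 'M[R]_N.
(* Expand prod_a (y - a) as prod_a ((y - A) + (A - a)). *)
Lemma char_poly_dvd_annihilator (A : M) (s : seq R) :
  \prod_(a <- s) (A - a%:M) = 0 :> M ->
  exists r, (\prod_(a <- s) ('X - a%:P)) ^+ N = char_poly A * r.
Proof.
pose Y := char_poly_mx A; pose PM : 'M[{poly R}]_N := map_mx polyC A.
have h : exists Q, (\prod_(a <- s) ('X - a%:P))%:M =
    map_mx polyC (\prod_(a <- s) (A - a%:M) : M) + Y *m Q.
  elim: s => [|a s [Q IHs]].
    by exists 0; rewrite !big_nil mulmx0 addr0; exact/esym/map_mx1.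
  exists (map_mx polyC (\prod_(a <- s) (A - a%:M) : M) + ('X - a%:P)%:M *m Q).
  rewrite !big_cons scalar_mxM IHs !mulmxDr map_mxM map_mxB map_scalar_mx /=.
  have -> : ('X - a%:P)%:M *m (Y *m Q) = Y *m (('X - a%:P)%:M *m Q).
    by rewrite !mulmxA scalar_mxC.
  rewrite !addrA -mulmxDl; congr (_ *m _ + _).
  by rewrite /Y /char_poly_mx raddfB /= [RHS]addrC addrA subrK.
move=> ann; case: h => Q; rewrite ann map_mx0 add0r => /(congr1 determinant).
by rewrite det_scalar det_mulmx => ->; exists (\det Q).
Qed.

End SplitCharPoly.

(** Over a domain, a monic divisor of a product of linear factors is a subproduct. The list records
    indices instead of roots, so it survives specializations that make roots coincide. *)
Lemma char_poly_split (R : idomainType) N (A : 'M[R]_N) (T : eqType) (f : T -> R) (s : seq T) :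
  \prod_(a <- s) (A - (f a)%:M) = 0 :> 'M_N ->
  exists2 l : seq T, {subset l <= s} & char_poly A = \prod_(a <- l) ('X - (f a)%:P).
Proof.
move=> ann; have [|r e] := @char_poly_dvd_annihilator _ _ A (map f s).
  by rewrite big_map.
have : char_poly A %| \prod_(a <- flatten (nseq N s)) ('X - (f a)%:P).
  suff <- : (\prod_(a <- map f s) ('X - a%:P)) ^+ N =
     \prod_(a <- flatten (nseq N s)) ('X - (f a)%:P) by rewrite e dvdp_mulIl.
  elim: (N) => [|k IHk] /=; first by rewrite big_nil.
  by rewrite exprS IHk big_cat big_map.
move=> /dvdp_prod_XsubC[m /eqp_eq]; set l := mask m _.
rewrite (monicP (char_poly_monic A)) (monicP (monic_prod_XsubC _ _ _)) !scale1r.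
move=> ->; exists l => // x /mem_mask /flattenP [s' /nseqP [-> _]] //.
Qed.

Lemma annihilated_diagonalizable (F : fieldType) N (A : 'M[F]_N) (s : seq F) :
  uniq s -> \prod_(a <- s) (A - a%:M) = 0 :> 'M_N -> diagonalizable A.
Proof.
case: N A => [|N] A us ann.
  exists 1%:M; first exact: unitmx1.
  by apply/is_diag_mxP => -[].
apply/diagonalizableP; exists s => //; apply: mxminpoly_min.
rewrite rmorph_prod -[RHS]ann; apply: eq_bigr => a _.
by rewrite rmorphB /= horner_mx_X horner_mx_C.
Qed.

Lemma diagonalizable_decomposition (F : fieldType) N (A : 'M[F]_N) :
  diagonalizable A -> exists (P : 'M_N) (d : 'rV_N),
    P \in unitmx /\ P *m A = diag_mx d *m P.
Proof.
by move=> [P Pu /similar_diagPex[d /(similarP Pu) e]]; exists P, d.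
Qed.

Lemma char_poly_conj (R : comNzRingType) N (P P' A A' : 'M[R]_N) :
  P *m P' = 1%:M -> P *m A = A' *m P -> char_poly A = char_poly A'.
Proof.
move=> PP' PA; set p := map_mx polyC P; set p' := map_mx polyC P'.
have pp' : p *m p' = 1%:M by rewrite -map_mxM PP' map_mx1.
have -> : char_poly A = \det (p *m char_poly_mx A *m p').
  by rewrite !det_mulmx mulrAC -det_mulmx pp' det1 mul1r.
rewrite /char_poly_mx mulmxBr scalar_mxC -map_mxM PA map_mxM -mulmxBl -mulmxA.
by rewrite pp' mulmx1.
Qed.

Lemma rank_diag_mx (F : fieldType) N (d : 'rV[F]_N) :
  (\rank (diag_mx d) + count_mem 0%R [seq d 0%R i | i : 'I_N])%N = N.
Proof.
elim: N d => [|N IHN] d.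
  by rewrite flatmx0 mxrank0 /image_mem enum_ord0.
rewrite /image_mem enum_ordSl /= -map_comp.
have -> : \rank (diag_mx d) =
    ((d 0%R ord0 != 0%R) + \rank (diag_mx (rsubmx (d : 'rV_(1 + N)))))%N.
  have -> : diag_mx d = block_mx (diag_mx (lsubmx (d : 'rV_(1 + N)))) 0 0
      (diag_mx (rsubmx (d : 'rV_(1 + N)))) :> 'M_(1 + N).
    by rewrite -diag_mx_row hsubmxK.
  apply: etrans (@rank_diag_block_mx F 1 1 N N _ _) _; rewrite rank_rV; congr (_ + _)%N.
  congr (nat_of_bool (~~ _)); apply/eqP/eqP => [/matrixP /(_ 0 0)|h].
    by rewrite !mxE eqxx mulr1n => <-; congr (d _ _); apply: val_inj.
  apply/matrixP => i j; rewrite !mxE !ord1 eqxx mulr1n -[RHS]h; congr (d _ _); exact: val_inj.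
rewrite -[in RHS](IHN (rsubmx (d : 'rV_(1 + N)))) /image_mem.
have -> : [seq rsubmx (d : 'rV_(1 + N)) 0 i | i <- enum 'I_N] =
    [seq ([eta d 0] \o lift ord0) i | i <- enum 'I_N].
  apply: eq_map => i; rewrite mxE /=; congr (d _ _); exact: val_inj.
by case: (d 0 ord0 == 0); rewrite !(add0n, add1n, addnS, addSn).
Qed.

Section Diagonalized.
Variables (F : fieldType) (N : nat) (A P : 'M[F]_N) (d : 'rV[F]_N).
Hypotheses (Pu : P \in unitmx) (PA : P *m A = diag_mx d *m P).

Lemma char_poly_diagonalized : char_poly A = \prod_i ('X - (d 0 i)%:P).
Proof.
rewrite (char_poly_conj (mulmxV Pu) PA) char_poly_trig ?diag_mx_is_trig //.
by apply: eq_bigr => i _; rewrite mxE eqxx mulr1n.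
Qed.

Lemma mxtrace_prod_diagonalized (s : seq F) :
  \tr (\prod_(a <- s) (A - a%:M) : 'M_N) = \sum_i \prod_(a <- s) (d 0 i - a).
Proof.
have h : P *m \prod_(a <- s) (A - a%:M) =
    diag_mx (\row_i \prod_(a <- s) (d 0 i - a)) *m P.
  elim: s => [|a s IHs].
    rewrite big_nil (_ : \row_i _ = const_mx 1) ?diag_const_mx; last first.
      by apply/rowP => i; rewrite !mxE big_nil.
    by rewrite mul1mx; exact: mulmx1.
  rewrite big_cons mulmxA mulmxBr PA scalar_mxC -mulmxBl -mulmxA IHs mulmxA.
  congr (_ *m _); rewrite -diag_const_mx -raddfB /= mulmx_diag; congr diag_mx.
  by apply/rowP => i; rewrite !mxE big_cons.
rewrite -[X in \tr X](mulKmx Pu) h mxtrace_mulC -mulmxA mulmxV // mulmx1.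
by rewrite mxtrace_diag; apply: eq_bigr => i _; rewrite mxE.
Qed.

Lemma rank_diagonalized : (\rank A + count_mem 0%R [seq d 0%R i | i : 'I_N])%N = N.
Proof.
have <- : \rank (P *m A) = \rank A by rewrite eqmxMfull ?row_full_unit.
by rewrite PA mxrankMfree ?row_free_unit // rank_diag_mx.
Qed.
End Diagonalized.

(** * Specialization of the parameter, and the multiplicities of the eigenvalues *)

Lemma map_shuffle (R S : comNzRingType) (f : {rmorphism R -> S}) N
    (t : nat -> 'M[R]_N) (t' : nat -> 'M[S]_N) m :
  (forall k, map_mx f (t k) = t' k) ->
  map_mx f (shuffle t m) = shuffle t' m.
Proof.
move=> tt'; elim: m => [|m IHm]; first exact: map_mx0.
rewrite [shuffle t _]/(1%:M + t m.-1 *m shuffle t m) map_mxD map_mxM map_mx1.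
by rewrite tt' IHm.
Qed.

Lemma map_shuffle_star (R S : comNzRingType) (f : {rmorphism R -> S}) N
    (t : nat -> 'M[R]_N) (t' : nat -> 'M[S]_N) m :
  (forall k, map_mx f (t k) = t' k) ->
  map_mx f (shuffle_star t m) = shuffle_star t' m.
Proof.
move=> tt'; elim: m => [|m IHm]; first exact: map_mx0.
rewrite [shuffle_star t _]/(1%:M + shuffle_star t m *m t m.-1) map_mxD map_mxM map_mx1.
by rewrite tt' IHm.
Qed.

Lemma trmx_shuffle (R : comNzRingType) N (t : nat -> 'M[R]_N) m :
  (forall k, (t k)^T = t k) -> (shuffle t m)^T = shuffle_star t m.
Proof.
move=> tt; elim: m => [|m IHm]; first exact: trmx0.
rewrite [shuffle t _]/(1%:M + t m.-1 *m shuffle t m) linearD /= trmx_mul trmx1.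
by rewrite tt IHm.
Qed.

(** Splitting once over K[X] gives a single list [l] for all values of q. *)
Lemma char_poly_specialize (K : fieldType) N (A : 'M[{poly K}]_N)
    (f : nat -> {poly K}) (s : seq nat) :
    \prod_(i <- s) (A - (f i)%:M) = 0 :> 'M_N ->
  exists2 l : seq nat, {subset l <= s} &
    forall q, char_poly (map_mx (horner_eval q) A) =
      \prod_(i <- l) ('X - ((f i).[q])%:P).
Proof.
move=> /char_poly_split[l ls e]; exists l => // q.
by rewrite -map_char_poly e map_prod_XsubC.
Qed.

Lemma qnum1 (R : pzRingType) m : qnum (1 : R) m = m%:R.
Proof.
by rewrite /qnum (eq_bigr (fun=> 1)) ?sumr_const ?card_ord // => i _; rewrite expr1n.
Qed.

Lemma prod_natr_sub (R : comNzRingType) m a :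
  \prod_(i <- rev (iota 0 a)) (m%:R - i%:R) = (m ^_ a)%:R :> R.
Proof.
elim: a => [|a IHa]; first by rewrite big_nil.
rewrite -addn1 iotaD rev_cat big_cat big_seq1 IHa addn1 ffactnSr add0n /=.
have [am|ma] := leqP a m; first by rewrite -natrB // -natrM mulnC.
by rewrite ffact_small // mulr0 mul0n.
Qed.

Lemma sum_count (F : nat -> nat) l M : {in l, forall m, m <= M}%N ->
  (\sum_(m <- l) F m = \sum_(m < M.+1) count_mem (m : nat) l * F m)%N.
Proof.
elim: l => [|x l IHl] lM; first by rewrite big_nil big1.
rewrite big_cons IHl; last by move=> m ml; apply: lM; rewrite inE ml orbT.
have xM : (x < M.+1)%N by rewrite ltnS lM ?mem_head.
rewrite [RHS](eq_bigr (fun m : 'I_M.+1 => (x == m) * F m + count_mem (m : nat) l * F m)%N).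
  rewrite big_split /=; congr (_ + _)%N; rewrite (bigD1 (Ordinal xM)) //= eqxx mul1n.
  by rewrite big1 ?addn0 // => i; rewrite -val_eqE eq_sym /= => /negbTE->.
by move=> i _; rewrite /= mulnDl.
Qed.

Lemma prod_count (R : comPzSemiRingType) (F : nat -> R) l M : {in l, forall m, m <= M}%N ->
  \prod_(m <- l) F m = \prod_(m < M.+1) F m ^+ count_mem (m : nat) l.
Proof.
elim: l => [|x l IHl] lM; first by rewrite big_nil big1.
rewrite big_cons IHl; last by move=> m ml; apply: lM; rewrite inE ml orbT.
have xM : (x < M.+1)%N by rewrite ltnS lM ?mem_head.
rewrite [RHS](eq_bigr (fun m : 'I_M.+1 => F m ^+ (x == m) * F m ^+ count_mem (m : nat) l)).
  rewrite big_split /=; congr (_ * _); rewrite (bigD1 (Ordinal xM)) //= eqxx expr1.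
  by rewrite big1 ?mulr1 // => i; rewrite -val_eqE eq_sym /= => /negbTE->.
by move=> i _; rewrite /= exprD.
Qed.

Section Spectrum.
Variables (K : numFieldType) (n : nat).
Local Notation W := 'S_n.+1.
Local Notation N := #|W|.

Definition regB (R : comNzRingType) (q : R) : 'M[R]_N := shuffle (regT n q) n.+1.
Definition regBstar (R : comNzRingType) (q : R) : 'M[R]_N := shuffle_star (regT n q) n.+1.

Lemma qnum_mx (R : comNzRingType) (q : R) m :
  qnum (q%:M : 'M_N) m = (qnum q m)%:M.
Proof. exact: (@qnum_morph R 'M[R]_N (@scalar_mx R N)). Qed.

Lemma regB_annihilated (R : comNzRingType) (q : R) :
  \prod_(i <- n.+1 :: rev (iota 0 n)) (regB q - (qnum q i)%:M) = 0 :> 'M_N.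
Proof.
rewrite -[RHS](shuffle_annihilated (regular_hecke_family n q) (ltn0Sn n) (leqnn _)).
by apply: eq_bigr => i _; rewrite qnum_mx.
Qed.

Lemma regBstar_annihilated (R : comNzRingType) (q : R) :
  \prod_(i <- rcons (iota 0 n) n.+1) (regBstar q - (qnum q i)%:M) = 0 :> 'M_N.
Proof.
rewrite -[RHS](shuffle_star_annihilated (regular_hecke_family n q) (ltn0Sn n) (leqnn _)).
by apply: eq_bigr => i _; rewrite qnum_mx.
Qed.

Lemma regB_roots_count (l : seq nat) : {in l, forall m, m <= n.+1}%N ->
    char_poly (regB (1 : K)) = \prod_(i <- l) ('X - i%:R%:P) ->
  forall m, (m <= n.+1)%N -> count_mem m l = ('C(n.+1, m) * derangements (n.+1 - m))%N.
Proof.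
move=> ln chi; apply: (@ffact_moments_inj n.+1) => a an.
rewrite sum_derangements_ffact // -(sum_count (fun m => m ^_ a)%N ln).
(* At q = 1 the candidate eigenvalues are distinct integers, in characteristic 0. *)
have [|P [d [Pu PA]]] := @diagonalizable_decomposition _ _ (regB (1 : K)).
  apply: (@annihilated_diagonalizable _ _ _ (map (fun i => i%:R) (n.+1 :: rev (iota 0 n)))).
    rewrite map_inj_uniq; last by move=> i j /eqP; rewrite eqr_nat => /eqP.
    by rewrite /= rev_uniq iota_uniq mem_rev mem_iota; lia.
  rewrite big_map -[RHS](regB_annihilated (1 : K)).
  by apply: eq_bigr => i _; rewrite qnum1.
have perm : perm_eq [seq d 0 i | i : 'I_N] (map (fun i => i%:R) l).
  apply: prod_XsubC_eq; rewrite [RHS]big_map -chi (char_poly_diagonalized Pu PA).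
  by rewrite /image_mem big_map big_enum.
apply/eqP; rewrite -(eqr_nat K) natr_sum -card_Sn.
(* The trace of C_a is computed twice: from the eigenvalues, as a sum of falling factorials, and
   from [mxtrace_shuffle_prod]. *)
have := mxtrace_prod_diagonalized Pu PA (map (fun i => i%:R) (rev (iota 0 a))).
rewrite big_map (eq_bigr (fun i => regB (1 : K) - qnum (1%:M : 'M_N) i)); last first.
  by move=> i _; rewrite qnum_mx qnum1.
rewrite (prod_shuffle_sub (regular_hecke_family n (1 : K))) //.
rewrite expr1n mul1r mxtrace_shuffle_prod // => ->.
pose F (x : K) := \prod_(b <- map (fun i => i%:R) (rev (iota 0 a))) (x - b).
have -> : \sum_i F (d 0 i) = \sum_(x <- [seq d 0 i | i : 'I_N]) F x.
  by rewrite [RHS]big_map big_enum.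
rewrite (perm_big _ perm) big_map; apply/eqP/eq_bigr => m _.
by rewrite /F big_map prod_natr_sub.
Qed.

Lemma horner_qnumX (q : K) i : (qnum ('X : {poly K}) i).[q] = qnum q i.
Proof.
by rewrite -[LHS]/(horner_eval q _) -qnum_morph /= /horner_eval hornerX.
Qed.

Lemma regB_roots : exists2 l : seq nat, {in l, forall m, m <= n.+1}%N &
  forall q : K, char_poly (regB q) = \prod_(i <- l) ('X - (qnum q i)%:P).
Proof.
have /char_poly_specialize[l ls chi] := regB_annihilated ('X : {poly K}).
exists l => [m /ls|q]; first by rewrite inE mem_rev mem_iota; lia.
have Tq k : map_mx (horner_eval q) (regT n 'X k) = regT n q k.
  by rewrite map_regT /= /horner_eval hornerX.
have -> : regB q = map_mx (horner_eval q) (regB 'X) by exact/esym/map_shuffle.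
rewrite chi.
by apply: eq_bigr => i _; rewrite horner_qnumX.
Qed.

Lemma regBstar_roots : exists2 l : seq nat, {in l, forall m, m <= n.+1}%N &
  forall q : K, char_poly (regBstar q) = \prod_(i <- l) ('X - (qnum q i)%:P).
Proof.
have /char_poly_specialize[l ls chi] := regBstar_annihilated ('X : {poly K}).
exists l => [m /ls|q]; first by rewrite mem_rcons inE mem_iota; lia.
have Tq k : map_mx (horner_eval q) (regT n 'X k) = regT n q k.
  by rewrite map_regT /= /horner_eval hornerX.
have -> : regBstar q = map_mx (horner_eval q) (regBstar 'X) by exact/esym/map_shuffle_star.
rewrite chi.
by apply: eq_bigr => i _; rewrite horner_qnumX.
Qed.

(** The counts in [l] do not depend on q, so the factorization at q = 1 determines them. *)
Lemma prod_roots_heckeChi (l : seq nat) (q : K) : {in l, forall m, m <= n.+1}%N ->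
    char_poly (regB (1 : K)) = \prod_(i <- l) ('X - i%:R%:P) ->
  \prod_(i <- l) ('X - (qnum q i)%:P) = heckeChi n.+1 q.
Proof.
move=> ln chi1; have cnt := regB_roots_count ln chi1.
rewrite (prod_count _ ln) /heckeChi (reindex_inj rev_ord_inj) /=.
apply: eq_bigr => i _; rewrite cnt /= subSS ?leq_subr //.
by rewrite bin_sub ?subKn // -ltnS.
Qed.

Lemma char_poly_regB (q : K) : char_poly (regB q) = heckeChi n.+1 q.
Proof.
have [l ln chi] := regB_roots; rewrite chi; apply: prod_roots_heckeChi => //.
by rewrite chi; apply: eq_bigr => i _; rewrite qnum1.
Qed.

Lemma regT1_sym (R : comNzRingType) k : (regT n (1 : R) k)^T = regT n 1 k.
Proof.
apply/matrixP => i j; rewrite !mxE /= !if_same subrr !if_same !mul0r !addr0 !mul1r.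
by rewrite eq_sym (can2_eq (@swapK n k) (@swapK n k)).
Qed.

(* At q = 1 the two matrices are transposes of each other, which forces the
   multiplicities of the eigenvalues to agree for all q. *)
Lemma char_poly_regBstar (q : K) : char_poly (regBstar q) = heckeChi n.+1 q.
Proof.
have [l ln chi] := regBstar_roots; rewrite chi; apply: prod_roots_heckeChi => //.
rewrite -(eq_bigr _ (fun i _ => congr1 (fun c : K => 'X - c%:P) (qnum1 K i))) -chi.
rewrite /regBstar -trmx_shuffle => [|k]; last exact: regT1_sym.
rewrite /char_poly -[LHS]det_tr; congr determinant.
by rewrite /char_poly_mx linearB /= tr_scalar_mx map_trmx.
Qed.

End Spectrum.

(** * The generators of H_n(q) and an upper bound for its dimension *)

Section HeckeGenerators.
Variables (K : fieldType) (n : nat) (q : K).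
Local Notation H := (hecke n q).

Definition heckeTn (k : nat) : H := oapp (heckeT q) 0 (insub k).

Lemma heckeTnE (i : 'I_n.-1) : heckeTn i = heckeT q i.
Proof. by rewrite /heckeTn valK. Qed.

Lemma hecke_family_heckeTn : hecke_family (q%:A : H) n.-1 heckeTn.
Proof.
have tE k (kn : (k < n.-1)%N) : heckeTn k = heckeT q (Ordinal kn).
  exact: (heckeTnE (Ordinal kn)).
split=> [x|k kn|i j ij jn|i iN].
- by rewrite mulr_algl mulr_algr.
- by rewrite (tE _ kn) heckeT_quad scalerBl scale1r mulrBl mulr_algl mul1r.
- have iN : (i < n.-1)%N by lia.
  by rewrite (tE _ jn) (tE _ iN) heckeT_comm.
- by rewrite (tE _ iN) (tE _ (ltnW iN)) heckeT_braid.
Qed.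

End HeckeGenerators.

Section DimensionBound.
Variables (K : fieldType) (H : falgType K) (q : K) (N : nat) (t : nat -> H).
Hypothesis tP : hecke_family (q%:A : H) N t.

(** These are the words t_{m-1} ... t_k for 0 <= k <= m, one for each right coset of S_m in
    S_{m+1}. *)
Fixpoint descents (m : nat) : seq H :=
  if m is m'.+1 then 1 :: [seq t m' * d | d <- descents m'] else [:: 1].

Definition gens (m : nat) : seq H := 1 :: [seq t j | j <- iota 0 m].

Fixpoint parabolic (m : nat) : {vspace H} :=
  if m is m'.+1 then (parabolic m' * <<descents m>>)%VS else 1%VS.

Lemma memv_span_mul (X : seq H) (U : {vspace H}) (v : H) :
  (forall x, x \in X -> x * v \in U) -> forall x, x \in <<X>>%VS -> x * v \in U.
Proof.
move=> h x xX; have /subvP/(_ x xX) : (<<X>> <= amulr v @^-1: U)%VS.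
  by apply/span_subvP => y yX; rewrite -memv_preim lfunE /=; apply: h.
by rewrite -memv_preim lfunE.
Qed.

Lemma memv_mul_span (X : seq H) (U : {vspace H}) (v : H) :
  (forall x, x \in X -> v * x \in U) -> forall x, x \in <<X>>%VS -> v * x \in U.
Proof.
move=> h x xX; have /subvP/(_ x xX) : (<<X>> <= amull v @^-1: U)%VS.
  by apply/span_subvP => y yX; rewrite -memv_preim lfunE /=; apply: h.
by rewrite -memv_preim lfunE.
Qed.

Lemma mem_gens m j : (j < m)%N -> t j \in <<gens m>>%VS.
Proof. by move=> jm; apply: memv_span; rewrite inE map_f ?orbT // mem_iota. Qed.

Lemma gens1 m : 1 \in <<gens m>>%VS.
Proof. by apply: memv_span; rewrite mem_head. Qed.

Lemma descents1 m : 1 \in <<descents m>>%VS.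
Proof. by apply: memv_span; case: m => [|m]; rewrite mem_head. Qed.

Lemma descents_head m d : d \in <<descents m>>%VS -> t m * d \in <<descents m.+1>>%VS.
Proof.
by apply: memv_mul_span => x xm; apply: memv_span; rewrite inE map_f ?orbT.
Qed.

Lemma gens_comm m j u : (m < j)%N -> (j < N)%N -> u \in <<gens m>>%VS -> t j * u = u * t j.
Proof.
move=> mj jN um; apply/esym/cent1vP; move: u um; apply/subvP/span_subvP => x.
rewrite inE => /predU1P[->|/mapP[k]]; first by apply/cent1vP; rewrite mulr1 mul1r.
by rewrite mem_iota => /andP[_ km] ->; apply/cent1vP; rewrite (hf_comm tP) //; lia.
Qed.

Lemma descents_comm m j d : (m < j)%N -> (j < N)%N -> d \in descents m -> t j * d = d * t j.
Proof.
move=> + jN; elim: m d => [|m IHm] d mj.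
  by rewrite inE => /eqP->; rewrite mulr1 mul1r.
rewrite inE => /predU1P[->|/mapP[e em ->]]; first by rewrite mulr1 mul1r.
by rewrite -mulrA -(IHm e (ltnW mj) em) !mulrA (hf_comm tP mj jN).
Qed.

(** Straightening: a generator on the right of a descending word is absorbed into such words, or
    comes out on the left with index below m. *)
Lemma descents_mul_gen m d j : (m < N)%N -> d \in descents m.+1 -> (j <= m)%N ->
  d * t j \in (<<gens m>> * <<descents m.+1>>)%VS.
Proof.
have inr k x : x \in <<descents k.+1>>%VS -> x \in (<<gens k>> * <<descents k.+1>>)%VS.
  by move=> xk; rewrite -[x]mul1r memv_mul ?gens1.
elim: m d j => [|m IHm] d j mN; rewrite inE => /predU1P[->|/mapP[e em ->]] jm.
- move: jm; rewrite leqn0 mul1r => /eqP->; apply: inr.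
  by have := descents_head (descents1 0); rewrite mulr1.
- move: jm em; rewrite leqn0 inE => /eqP-> /eqP->; rewrite mulr1 (hf_quad tP) //.
  apply: inr; apply: rpredD; last by rewrite rpredZ ?descents1.
  have := descents_head (descents1 0); rewrite mulr1 => tm.
  by rewrite mulrBl mulr_algl mul1r rpredB ?rpredZ.
- rewrite mul1r; have [jm'|mj] := ltnP j m.+1.
    by rewrite -[t j]mulr1 memv_mul ?mem_gens ?descents1.
  have -> : j = m.+1 by lia.
  by apply: inr; have := descents_head (descents1 m.+1); rewrite mulr1.
have [jm'|mj] := ltnP j m.+1.
  rewrite -mulrA; have := IHm _ _ (ltnW mN) em jm'.
  have sub : (<<gens m>> * <<descents m.+1>> <=
      amull (t m.+1) @^-1: (<<gens m.+1>> * <<descents m.+2>>))%VS.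
    apply/prodvP => u v um vm; rewrite -memv_preim lfunE /= mulrA (gens_comm _ _ um) //.
    rewrite -mulrA memv_mul ?descents_head //.
    move: u um; apply/subvP/span_subvP => x.
    rewrite inE => /predU1P[->|/mapP[i im ->]]; first exact: gens1.
    by apply: mem_gens; move: im; rewrite mem_iota; lia.
  by move=> /(subvP sub); rewrite -memv_preim lfunE.
have {mj jm} -> : j = m.+1 by lia.
move: em; rewrite inE => /predU1P[->|/mapP[f fm ->]].
  rewrite mulr1 (hf_quad tP) //.
  apply: inr; apply: rpredD; last by rewrite rpredZ ?descents1.
  have := descents_head (descents1 m.+1); rewrite mulr1 => tm.
  by rewrite mulrBl mulr_algl mul1r rpredB ?rpredZ.
(* [t m.+1] commutes with [f], and then the braid relation applies. *)
have -> : t m.+1 * (t m * f) * t m.+1 = t m * (t m.+1 * (t m * f)).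
  rewrite -!mulrA -(descents_comm _ _ fm) //.
  have /(congr1 (fun z => z * f)) := hf_braid tP mN.
  by rewrite -!mulrA => ->.
by rewrite memv_mul ?mem_gens ?descents_head ?memv_span.
Qed.

(** Straightening moves the generators to the left of the descending words, where the smaller
    parabolic absorbs them by induction. *)
Lemma parabolic_closed m : (m <= N)%N -> (parabolic m * <<gens m>> <= parabolic m)%VS.
Proof.
elim: m => [|m IHm] mN.
  rewrite /gens /= -[1]/(1 : H) span_seq1 -/(1%VS) prodv1 //.
rewrite -prodvA.
apply: subv_trans (prodvS (IHm (ltnW mN)) (subvv _)).
rewrite -prodvA prodvSr //.
apply/prodvP => u v um vm; move: v vm; apply: memv_mul_span => v vm; move: u um.
apply: memv_span_mul => u um.
move: vm; rewrite inE => /predU1P[->|/mapP[j]].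
  by rewrite mulr1 -[u]mul1r memv_mul ?gens1 ?memv_span.
by rewrite mem_iota => /andP[_ jm] ->; apply: descents_mul_gen.
Qed.

Lemma parabolic1 m : 1 \in parabolic m.
Proof.
elim: m => [|m IHm]; first exact: memv_line.
by have := memv_mul IHm (descents1 m.+1); rewrite mulr1.
Qed.

Lemma dim_parabolic m : (\dim (parabolic m) <= m.+1`!)%N.
Proof.
elim: m => [|m IHm]; first by rewrite dimv1.
apply: leq_trans (dim_prodv _ _) _; rewrite factS mulnC leq_mul //.
apply: leq_trans (dim_span _) _.
by elim: m {IHm} => [|m IHm] //=; rewrite size_map.
Qed.

End DimensionBound.

Lemma dim_hecke_le (K : fieldType) n (q : K) : (\dim {:hecke n.+1 q} <= n.+1`!)%N.
Proof.
have tP := hecke_family_heckeTn n.+1 q.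
suff -> : {:hecke n.+1 q}%VS = parabolic (@heckeTn K n.+1 q) n by apply: dim_parabolic.
apply/eqP; rewrite eqEsubv subvf andbT; apply/subvP => x _.
have cl := parabolic_closed tP (leqnn n).
have one := parabolic1 (@heckeTn K n.+1 q) n.
rewrite -[x]mul1r; move: (1 : hecke _ _) one.
elim/hecke_ind: x => [a|i|u v IHu IHv|u v IHu IHv] y ym.
- by rewrite mulr_algr rpredZ.
- rewrite -heckeTnE; apply: (subvP cl); rewrite memv_mul //.
  exact: mem_gens.
- by rewrite mulrDr rpredD ?IHu ?IHv.
- by rewrite mulrA; apply/IHv/IHu.
Qed.

(** * The defining sums of B_n and B*_n, and the universal property of the presentation *)

Lemma shuffle_sum (A : pzRingType) (t : nat -> A) m :
  \sum_(i < m.+1) \prod_(k <- rev (iota 0 m) | (i <= k)%N) t k = shuffle t m.+1.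
Proof.
elim: m => [|m IHm]; first by rewrite big_ord_recl big_ord0 /= big_nil mulr0.
rewrite [RHS]/(1 + t m * shuffle t m.+1) -IHm.
have -> : rev (iota 0 m.+1) = m :: rev (iota 0 m) by rewrite -addn1 iotaD rev_cat.
rewrite [LHS]big_ord_recr /= addrC.
congr (_ + _).
  rewrite big_seq_cond big1 // => k /andP[+ mk].
  by rewrite inE mem_rev mem_iota /= in mk *; lia.
rewrite mulr_sumr; apply: eq_bigr => i _.
by rewrite big_cons /= -ltnS ltn_ord.
Qed.

Lemma shuffle_star_sum (A : pzRingType) (t : nat -> A) m :
  \sum_(i < m.+1) \prod_(k <- iota 0 m | (i <= k)%N) t k = shuffle_star t m.+1.
Proof.
rewrite -[RHS](@shuffle_sum A^c t m); apply: eq_bigr => i _.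
by rewrite rev_prodr revK.
Qed.

Lemma heckeB_shuffle (K : fieldType) n (q : K) :
  heckeB n.+1 q = shuffle (heckeTn n.+1 q) n.+1.
Proof.
rewrite -shuffle_sum; apply: eq_bigr => i _; rewrite -val_enum_ord -map_rev big_map.
by apply: eq_bigr => k _; rewrite (@heckeTnE K n.+1 q).
Qed.

Lemma heckeBstar_shuffle (K : fieldType) n (q : K) :
  heckeBstar n.+1 q = shuffle_star (heckeTn n.+1 q) n.+1.
Proof.
rewrite -shuffle_star_sum; apply: eq_bigr => i _.
rewrite (eq_bigr _ (fun k _ => esym (@heckeTnE K n.+1 q k))).
by rewrite -(big_mkord (fun k => i <= k)%N) /index_iota subn0.
Qed.

Section HeckeLift.
Variables (K : fieldType) (n : nat) (q : K) (A : pzRingType).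
Variables (c : {rmorphism K -> A}) (t : nat -> A).
Hypothesis cC : forall a x, c a * x = x * c a.
Hypothesis tP : hecke_family (c q) n.-1 t.

Fixpoint heval (x : hterm K n) : A :=
  match x with
  | HCst a => c a
  | HGen i => t i
  | HAdd y z => heval y + heval z
  | HMul y z => heval y * heval z
  end.

Lemma heval_heq x y : heq q x y -> heval x = heval y.
Proof.
elim=> //=.
- by move=> {}x {}y z _ -> _ ->.
- by move=> {}x x' {}y y' _ -> _ ->.
- by move=> {}x x' {}y y' _ -> _ ->.
- by move=> *; rewrite addrA.
- by move=> *; rewrite addrC.
- by move=> *; rewrite rmorph0 add0r.
- by move=> *; rewrite mulrA.
- by move=> *; rewrite rmorph1 mul1r.
- by move=> *; rewrite rmorph1 mulr1.
- by move=> *; rewrite rmorph0 mul0r.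
- by move=> *; rewrite mulrDl.
- by move=> *; rewrite mulrDr.
- by move=> a b; rewrite rmorphD.
- by move=> a b; rewrite rmorphM.
- by move=> i; rewrite (hf_quad tP) // rmorphB rmorph1.
- by move=> i j ij; rewrite (hf_comm tP).
- by move=> i j ij; rewrite ij (hf_braid tP) // -ij.
Qed.

Definition hlift (u : hecke n q) : A := heval (hrepr u).

Lemma hliftE x : hlift (hclass q x) = heval x.
Proof. exact/heval_heq/hrepr_class. Qed.

Lemma hliftD u v : hlift (u + v) = hlift u + hlift v.
Proof.
by elim/hclass_ind: u => x; elim/hclass_ind: v => y; rewrite -hclass_add !hliftE.
Qed.

Lemma hliftM u v : hlift (u * v) = hlift u * hlift v.
Proof.
by elim/hclass_ind: u => x; elim/hclass_ind: v => y; rewrite -hclass_mul !hliftE.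
Qed.

Lemma hliftC a : hlift a%:A = c a.
Proof. by rewrite -hclass_cst hliftE. Qed.

Lemma hliftZ a u : hlift (a *: u) = c a * hlift u.
Proof. by rewrite -mulr_algl hliftM hliftC. Qed.

Lemma hlift0 : hlift 0 = 0.
Proof. by rewrite -(scale0r 1) hliftC rmorph0. Qed.

Lemma hlift1 : hlift 1 = 1.
Proof. by rewrite -(scale1r 1) hliftC rmorph1. Qed.

Lemma hliftT i : hlift (heckeT q i) = t i.
Proof. exact: hliftE. Qed.

Lemma hliftTn k : (k < n.-1)%N -> hlift (heckeTn n q k) = t k.
Proof. by move=> kn; rewrite (heckeTnE q (Ordinal kn)) hliftT. Qed.

Lemma hlift_shuffle m : (m <= n)%N -> hlift (shuffle (heckeTn n q) m) = shuffle t m.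
Proof.
elim: m => [|m IHm] mn; first exact: hlift0.
rewrite /= hliftD hlift1 hliftM IHm; last exact: ltnW.
case: m mn {IHm} => [|m] mn; first by rewrite /= !mulr0.
by rewrite hliftTn //; lia.
Qed.

Lemma hlift_shuffle_star m : (m <= n)%N ->
  hlift (shuffle_star (heckeTn n q) m) = shuffle_star t m.
Proof.
elim: m => [|m IHm] mn; first exact: hlift0.
rewrite !shuffle_starS hliftD hlift1 hliftM IHm; last exact: ltnW.
case: m mn {IHm} => [|m] mn; first by rewrite /shuffle_star /= !mul0r.
by rewrite hliftTn //; lia.
Qed.

Lemma hlift_shuffle_prod a m : (m <= n)%N ->
  hlift (shuffle_prod (heckeTn n q) m a) = shuffle_prod t m a.
Proof.
move=> mn; elim: a => [|a IHa]; first exact: hlift1.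
by rewrite /= hliftM IHa hlift_shuffle //; lia.
Qed.

End HeckeLift.

(** * Comparison of H_n(q) with its regular representation *)

Section Intertwiner.
Variables (K : fieldType) (n : nat) (q : K).
Local Notation H := (hecke n.+1 q).
Local Notation W := 'S_n.+1.
Local Notation N := #|W|.
Local Notation d := (\dim {:H}).
Local Notation e := (vbasis {:H}).

Definition hrho (u : H) : 'M[K]_N := hlift (@scalar_mx K N) (regT n q) u.

Let cC (a : K) (x : 'M[K]_N) : a%:M * x = x * a%:M.
Proof. exact/esym/scalar_mxC. Qed.

Let tP : hecke_family (A := 'M[K]_N) (q%:M) n.+1.-1 (regT n q).
Proof. exact: regular_hecke_family. Qed.

Lemma hrhoM u v : hrho (u * v) = hrho u *m hrho v.
Proof. exact: hliftM. Qed.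

Lemma hrhoD u v : hrho (u + v) = hrho u + hrho v.
Proof. exact: hliftD. Qed.

Lemma hrhoZ a u : hrho (a *: u) = a *: hrho u.
Proof. by rewrite -mul_scalar_mx; apply: hliftZ. Qed.

Lemma hrho_heckeB : hrho (heckeB n.+1 q) = regB n q.
Proof. by rewrite heckeB_shuffle; apply: hlift_shuffle. Qed.

Lemma hrho_heckeBstar : hrho (heckeBstar n.+1 q) = regBstar n q.
Proof. by rewrite heckeBstar_shuffle; apply: hlift_shuffle_star. Qed.

(** This evaluates the representation at its cyclic vector, and so intertwines right multiplication
    in [H] with [hrho]. *)
Definition hvec (u : H) : 'rV[K]_N := row (enum_rank (1%g : W)) (hrho u).

Lemma hvecM u v : hvec (u * v) = hvec u *m hrho v.
Proof. by rewrite /hvec hrhoM row_mul. Qed.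

Lemma hvecD u v : hvec (u + v) = hvec u + hvec v.
Proof. by rewrite /hvec hrhoD linearD. Qed.

Lemma hvecZ a u : hvec (a *: u) = a *: hvec u.
Proof. by rewrite /hvec hrhoZ linearZ. Qed.

Lemma hvec_surj x : exists u, hvec u = x.
Proof.
have hdelta w : exists u, hvec u = delta_mx 0 (enum_rank w).
  apply: (@regular_cyclic n K q (fun y => exists u, hvec u = y)) => [|k y kn [u <-]].
    exists 1; rewrite /hvec [hrho 1](hlift1 cC tP) rowE; exact: mulmx1.
  by exists (u * heckeTn n.+1 q k); rewrite hvecM /hrho (hliftTn cC tP).
rewrite [x]row_sum_delta; elim/big_rec: _ => [|i y _ [u <-]].
  by exists 0; rewrite /hvec [hrho 0](hlift0 cC tP) linear0.
have [v vE] := hdelta (enum_val i).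
by exists (x 0 i *: v + u); rewrite hvecD hvecZ vE enum_valK.
Qed.

Definition hvec_mx : 'M[K]_(d, N) := \matrix_(i < d) hvec e`_i.

Lemma rVof_hvec_mx u : passmx.rVof e u *m hvec_mx = hvec u.
Proof.
have hvec0 : hvec 0 = 0 by rewrite -(scale0r 0) hvecZ scale0r.
rewrite [in RHS](coord_vbasis (memvf u)) mulmx_sum_row.
rewrite (big_morph hvec hvecD hvec0); apply: eq_bigr => i _.
by rewrite hvecZ rowK mxE.
Qed.

Lemma endmx_hvec_mx b : endmx (amulr b) *m hvec_mx = hvec_mx *m hrho b.
Proof.
apply/row_matrixP => i; rewrite !row_mul rowE -mulmxA.
have eb := vbasisP {:H}.
have -> : delta_mx 0 i = passmx.rVof e e`_i by rewrite passmx.rVofE ?(basis_free eb).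
rewrite mulmxA /endmx -passmx.rVof_app // rVof_hvec_mx lfunE /= hvecM.
by rewrite rowK.
Qed.

Lemma row_full_hvec_mx : row_full hvec_mx.
Proof.
rewrite -sub1mx; apply/row_subP => i; rewrite row1.
have [u <-] := hvec_surj (delta_mx 0 i).
by rewrite -rVof_hvec_mx submxMl.
Qed.

(** Straightening gives one inequality, surjectivity of [hvec] the other; [hvec] is then
    bijective. *)
Lemma dim_hecke : d = N.
Proof.
apply/eqP; rewrite eqn_leq {1}card_Sn dim_hecke_le /=.
by have := rank_leq_row hvec_mx; rewrite (eqP row_full_hvec_mx).
Qed.

End Intertwiner.

(** The sizes d and N agree only by a proved equation, so P is rectangular until that equation is
    eliminated; it is then a conjugating matrix. *)
Lemma row_full_conj (F : fieldType) d N (E : 'M[F]_d) (M : 'M[F]_N) (P : 'M[F]_(d, N)) :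
    d = N -> row_full P -> E *m P = P *m M ->
  [/\ char_poly E = char_poly M, diagonalizable M -> diagonalizable E
    & \rank E = \rank M].
Proof.
move=> dN; case: _ / dN in M P *; rewrite row_full_unit => Pu EP; split.
- by apply/esym/(char_poly_conj (mulmxV Pu))/esym.
- move=> /diagonalizable_decomposition[Q [D [Qu QM]]].
  have QPu : Q *m invmx P \in unitmx by rewrite unitmx_mul Qu unitmx_inv.
  exists (Q *m invmx P) => //; apply/similar_diagPex; exists D; apply/(similarP QPu).
  have PE : invmx P *m E = M *m invmx P.
    by rewrite -[E in LHS](mulmxK Pu) EP -!mulmxA mulKmx.
  by rewrite -mulmxA PE !mulmxA QM.
by rewrite -(mxrankMfree E (_ : row_free P)) ?row_free_unit // EP eqmxMfull // row_full_unit.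
Qed.

Import passmx.

Lemma dim_vsof (F : fieldType) (V : vectType F) (e : (\dim {:V}).-tuple V)
    (eb : basis_of {:V} e) (M : 'M[F]_(\dim {:V})) :
  \dim (passmx.vsof e M) = \rank M.
Proof.
set B := row_base M; pose X := [tuple passmx.vecof e (row i B) | i < \rank M].
have rX (k : 'I_(\rank M) -> F) :
    passmx.rVof e (\sum_i k i *: X`_i) = (\row_i k i) *m B.
  rewrite linear_sum mulmx_sum_row; apply: eq_bigr => i _.
  by rewrite linearZ mxE nth_mktuple /= vecofK // (basis_free eb).
have -> : passmx.vsof e M = <<X>>%VS.
  apply/eqP; rewrite eqEsubv; apply/andP; split; apply/subvP => v.
    rewrite -passmx.rVof_sub // -(eq_row_base M) => /submxP[k ke].
    have -> : v = \sum_i k 0 i *: X`_i.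
      apply: (can_inj (passmx.rVofK eb)); rewrite rX ke; congr (_ *m _).
      by apply/rowP => i; rewrite mxE.
    by apply: rpred_sum => i _; rewrite rpredZ // memv_span // mem_nth // size_tuple.
  move=> /coord_span ->.
  by rewrite -passmx.rVof_sub // rX -(eq_row_base M) submxMl.
suff /eqP -> : free X by rewrite size_tuple.
apply/freeP => k k0 i; have := rX k; rewrite k0 linear0 => /esym/eqP.
by rewrite mulmx_free_eq0 ?row_base_free // => /eqP/rowP/(_ i); rewrite !mxE.
Qed.

Lemma dim_lker_endmx (F : fieldType) (V : vectType F) (f : 'End(V)) :
  (\dim (lker f) + \rank (endmx f))%N = \dim {:V}.
Proof.
have eb := vbasisP {:V}.
by rewrite (passmx.lker_ker eb) dim_vsof // mxrank_ker subnK // rank_leq_row.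
Qed.

(** * Semisimplicity forces the q-integers to be nonzero *)

Section Nonvanishing.
Variables (K : fieldType) (n : nat) (q : K).
Local Notation H := (hecke n.+1 q).
Hypothesis ss : semisimple_alg H.

(** Write 1 = a x + z with z in a complement J of the left ideal K x. Then x = x z lies in J as
    well, hence is 0. *)
Lemma semisimple_no_square_zero (x : H) :
  (forall h, exists a, h * x = a *: x) -> x * x = 0 -> x = 0.
Proof.
move=> hx xx; have [|J [Jl Jf J0]] := ss (I := <[x]>%VS).
  move=> h y /vlineP[a ->]; have [b hb] := hx h.
  by rewrite -scalerAr hb scalerA rpredZ ?memv_line.
have : (1 : H) \in (<[x]> + J)%VS by rewrite Jf memvf.
move=> /memv_addP[y /vlineP[a ->] [z zJ e1]].
apply/eqP; rewrite -memv0 -J0 memv_cap memv_line /=.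
by rewrite -[x]mulr1 e1 mulrDr -scalerAr xx scaler0 add0r Jl.
Qed.

Let qC (a x : K) : idfun a * x = x * idfun a. Proof. exact: mulrC. Qed.

Let index_family : hecke_family (idfun q) n.+1.-1 (fun=> q).
Proof.
split=> [x|k _|//|//]; first exact: mulrC.
by rewrite mulrBl mul1r subrK.
Qed.

Lemma shuffle_index m : shuffle (fun=> q) m = qnum q m.
Proof.
elim: m => [|m IHm]; first by rewrite /qnum big_ord0.
by rewrite qnumS /= IHm.
Qed.

Lemma qint_neq0 m : (0 < m <= n.+1)%N -> qint q m != 0.
Proof.
move=> /andP[m0 mn]; apply/eqP => qm.
set t := heckeTn n.+1 q; pose x := shuffle_prod t n.+1 n.+1.
have tP := hecke_family_heckeTn n.+1 q.
pose chi : H -> K := hlift idfun (fun=> q).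
have hx h : h * x = chi h *: x.
  elim/hecke_ind: h => [a|i|u v IHu IHv|u v IHu IHv].
  - by rewrite /chi (hliftC qC index_family) mulr_algl.
  - rewrite /chi (hliftT qC index_family) -heckeTnE.
    by rewrite (shuffle_prod_eigen tP) ?mulr_algl //= ?subnn // ltnS.
  - by rewrite /chi (hliftD qC index_family) mulrDl IHu IHv scalerDl.
  - rewrite /chi (hliftM qC index_family) -mulrA IHv -scalerAr IHu.
    by rewrite scalerA mulrC.
(* The index character sends B_i to [i]_q, so x goes to the product of [1]_q, ..., [n+1]_q, which
   contains the vanishing factor [m]_q. *)
have chix : chi x = 0.
  rewrite /chi (hlift_shuffle_prod qC index_family) //.
  have : (n.+1 - m < n.+1)%N by lia.
  move: {2 4}n.+1 => a; elim: a => // a IHa am.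
  have [<-|neq] := eqVneq (n.+1 - m)%N a; last by rewrite /= IHa ?mulr0 //; lia.
  by rewrite /= subKn // shuffle_index -[qnum q m]/(qint q m) qm mul0r.
have x0 : x = 0.
  apply: semisimple_no_square_zero => [h|]; first by exists (chi h).
  by rewrite hx chix scale0r.
have := @shuffle_prod_coef1 n K q n.+1 (leqnn _).
have e1 : hrho x = 0 by rewrite x0 -(scale0r (1 : H)) hrhoZ scale0r.
move: e1; rewrite /hrho /x hlift_shuffle_prod // => [->|a y|].
- by rewrite mxE => /eqP; rewrite eq_sym oner_eq0.
- exact/esym/scalar_mxC.
- exact: regular_hecke_family.
Qed.

End Nonvanishing.

(** * The algebra at q = 0 *)

Section ZeroParameter.
Variables (K : fieldType) (n : nat).
Local Notation H := (hecke n.+1 (0 : K)).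

(* A module of dimension 2 over the algebra with parameter 0 that is a nonsplit
   extension of two characters. *)
Definition uptri (k : nat) : 'M[K]_2 :=
  - (if k is 0%N then delta_mx 0 0 + delta_mx 0 1
     else if k is 1%N then delta_mx 1 1 else 0).

Lemma uptri_family : hecke_family (A := 'M[K]_2) (0%:M) n.+1.-1 uptri.
Proof.
have l1 : lift ord0 ord0 = 1 :> 'I_2 by apply: val_inj.
pose a : 'M[K]_2 := delta_mx 0 0 + delta_mx 0 1; pose b : 'M[K]_2 := delta_mx 1 1.
have aa : a *m a = a.
  apply/matrixP => i j; rewrite !mxE big_ord_recl big_ord1 l1 !mxE /=.
  by case: (i == 0); case: (j == 0); case: (j == 1); rewrite /=; ring.
have bb : b *m b = b by rewrite mul_delta_mx.
have ba : b *m a = 0.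
  apply/matrixP => i j; rewrite !mxE big_ord_recl big_ord1 l1 !mxE /=.
  by rewrite !andbF /=; ring.
have t0 : uptri 0 = - a by [].
have t1 : uptri 1 = - b by [].
have t2 k : uptri k.+2 = 0 by rewrite /uptri oppr0.
split=> [x|k _|i j ij _|i _].
- exact/esym/scalar_mxC.
- rewrite raddf0 addr0 sub0r mulN1r -mulmxE.
  case: k => [|[|k]]; rewrite ?t0 ?t1 ?t2 ?mulmx0 ?oppr0 // mulNmx mulmxN ?aa ?bb //.
- by case: j ij => [|[|j]] // _; rewrite t2 mulr0 mul0r.
case: i => [|i]; last by rewrite t2 !(mul0r, mulr0).
rewrite t0 t1 -!mulmxE !(mulmxN, mulNmx) ba mulmx0 oppr0 mulmxA ba mul0mx.
by rewrite !oppr0.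
Qed.

Let cC (a : K) (x : 'M[K]_2) : a%:M * x = x * a%:M.
Proof. exact/esym/scalar_mxC. Qed.

Definition uprep (u : H) : 'M[K]_2 := hlift (@scalar_mx K 2) uptri u.

Definition upchar (u : H) : K^o := uprep u 1 1.

Lemma upchar_linear : linear upchar.
Proof.
move=> a u v; rewrite /upchar /uprep (hliftD cC uptri_family) (hliftZ cC uptri_family).
by rewrite -mulmxE mul_scalar_mx !mxE.
Qed.

HB.instance Definition _ := GRing.isSemilinear.Build K _ _ _ upchar
  (GRing.semilinear_linear upchar_linear).

Lemma uprep_lower u : uprep u 1 0 = 0.
Proof.
elim/hecke_ind: u => [a|i|u v IHu IHv|u v IHu IHv]; rewrite /uprep.
- by rewrite (hliftC cC uptri_family) mxE.
- rewrite (hliftT cC uptri_family) /uptri.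
  by case: (i : nat) => [|[|k]]; rewrite !mxE /= ?addr0 oppr0.
- by rewrite (hliftD cC uptri_family) mxE [X in X + _]IHu [X in _ + X]IHv addr0.
rewrite (hliftM cC uptri_family) mxE big_ord_recl big_ord1.
rewrite (_ : lift ord0 ord0 = 1); last exact: val_inj.
by rewrite [X in X * _]IHu [X in _ + _ * X]IHv mul0r mulr0 addr0.
Qed.

Lemma upcharM u v : upchar (u * v) = upchar u * upchar v.
Proof.
rewrite /upchar {1}/uprep (hliftM cC uptri_family) mxE big_ord_recl big_ord1.
rewrite (_ : lift ord0 ord0 = 1); last exact: val_inj.
by rewrite [X in X * _]uprep_lower mul0r add0r.
Qed.

(** A left complement of the kernel of [upchar] would contain a z on which H acts through [upchar],
    and [uprep z] would then split the extension. *)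
Lemma not_semisimple0 : (1 < n)%N -> ~ semisimple_alg H.
Proof.
move=> n1 ss; have := ss (lker (linfun upchar)); case.
  by move=> a x; rewrite !memv_ker !lfunE /= upcharM => /eqP->; rewrite mulr0.
move=> J [Jl Jf J0].
have chi1 : upchar 1 = 1 by rewrite /upchar /uprep (hlift1 cC uptri_family) mxE.
have : (1 : H) \in (lker (linfun upchar) + J)%VS by rewrite Jf memvf.
move=> /memv_addP[y yI [z zJ e1]].
have yz : y = 1 - z by rewrite e1 addrK.
have y0 : upchar y = 0 by move: yI; rewrite memv_ker lfunE => /eqP.
have zchi : upchar z = 1.
  by move: y0; rewrite yz linearB /= chi1 => /eqP; rewrite subr_eq0 => /eqP <-.
have hz (h : H) : h * z = (upchar h : K) *: z.
  have e : h * z - (upchar h : K) *: z = (h - (upchar h : K)%:A) * z.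
    by rewrite mulrBl mulr_algl.
  apply/eqP; rewrite -subr_eq0 e -memv0 -J0 memv_cap.
  rewrite Jl // andbT memv_ker lfunE /= upcharM linearB linearZ /= chi1.
  by rewrite [_ *: _]mulr1 subrr mul0r.
have hw h i : \sum_j uprep h i j * uprep z j 1 = upchar h * uprep z i 1.
  have := congr1 (fun u => uprep u i 1) (hz h).
  by rewrite /uprep (hliftM cC uptri_family) (hliftZ cC uptri_family)
    -!mulmxE mul_scalar_mx !mxE.
have T k (kn : (k < n)%N) : uprep (heckeTn n.+1 0 k) = uptri k.
  by rewrite /uprep (hliftTn cC uptri_family).
have l1 : lift ord0 ord0 = 1 :> 'I_2 by apply: val_inj.
(* In row 0, generator 0 forces [uprep z 0 1] to be -1 and generator 1 forces it to be 0. *)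
have := hw (heckeTn n.+1 0 0%N) 0; rewrite /upchar T ?(ltnW n1) // big_ord_recl big_ord1 l1.
have := hw (heckeTn n.+1 0 1%N) 0; rewrite /upchar T // big_ord_recl big_ord1 l1.
rewrite [uprep z 1 1]zchi !mxE /= !(mulr0, mul0r, add0r, addr0, oppr0, mulr1, mulN1r).
move=> /eqP; rewrite eq_sym oppr_eq0 => /eqP->.
by rewrite oppr0 add0r => /eqP; rewrite oppr_eq0 oner_eq0.
Qed.

End ZeroParameter.

(** * Simplicity of the roots, and the conclusion *)

Lemma qintE (K : fieldType) (q : K) m : qint q m = qnum q m.
Proof. by []. Qed.

Lemma qnum_sub (R : pzRingType) (q : R) i j : (j <= i)%N ->
  qnum q i - qnum q j = q ^+ j * qnum q (i - j).
Proof.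
move=> ji; rewrite /qnum -!(big_mkord xpredT (fun k => q ^+ k)).
rewrite (big_cat_nat (n := j)) //= addrAC subrr add0r -{1}[j]add0n big_addn mulr_sumr.
by apply: eq_bigr => k _; rewrite -exprD addnC.
Qed.

Lemma qint_roots_uniq (K : fieldType) n (q : K) : semisimple_alg (hecke n.+1 q) ->
  uniq [seq qint q i | i <- n.+1 :: rev (iota 0 n)].
Proof.
move=> ss; have nz := qint_neq0 ss.
(* For n <= 1 the roots are [1]_q alone, or [2]_q and 0, so q = 0 needs no exclusion. *)
have [n1|n1] := leqP n 1.
  case: n ss nz n1 => [|[|n]] // ss nz _; rewrite /= inE andbT.
  by rewrite {2}/qint big_ord0 nz.
have q0 : q != 0.
  by apply/eqP => q0; move: ss; rewrite q0; apply: not_semisimple0.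
rewrite map_inj_in_uniq; first by rewrite /= rev_uniq iota_uniq mem_rev mem_iota; lia.
have inj i j : (i <= n.+1)%N -> (j <= i)%N -> qint q i = qint q j -> i = j.
  move=> im ji /eqP; rewrite -subr_eq0 !qintE qnum_sub // mulf_eq0 expf_eq0.
  rewrite (negbTE q0) andbF /=.
  by apply: contraTeq => ij; apply: nz; lia.
have le i : i \in n.+1 :: rev (iota 0 n) -> (i <= n.+1)%N.
  by rewrite inE mem_rev mem_iota; lia.
move=> i j /le li /le lj e; have [ji|/ltnW ij] := leqP j i; first exact: inj.
by apply/esym/inj.
Qed.

Lemma heckeP_roots (K : fieldType) n (q : K) s : perm_eq s (n.+1 :: rev (iota 0 n)) ->
  heckeP n.+1 q = \prod_(i <- s) ('X - (qint q i)%:P).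
Proof.
move=> /(perm_big _)->; rewrite /heckeP (reindex_inj rev_ord_inj) /= big_cons.
rewrite (perm_big _ (perm_refl _)) /=.
rewrite (eq_bigr (fun i : 'I_n.+2 => 'X - (qint q i)%:P)); last first.
  by move=> i _; rewrite subSS subKn // -ltnS.
rewrite (eq_bigl (fun i : 'I_n.+2 => (i : nat) != n)); last first.
  by move=> i; rewrite subSS; have := ltn_ord i; lia.
rewrite big_mkcond big_ord_recr /= big_ord_recr /= eqxx mulr1 mulrC.
rewrite -[(n.+1 == n)]/(_) (_ : (n.+1 != n)%N); last by lia.
congr (_ * _).
rewrite (perm_big (iota 0 n)) ?perm_rev //=.
have -> : iota 0 n = index_iota 0 n by rewrite /index_iota subn0.
rewrite big_mkord; apply: eq_bigr => i _.
by rewrite (_ : (i : nat) != n) // neq_ltn ltn_ord.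
Qed.

Section Conclusion.
Variables (K : numFieldType) (n : nat) (q : K).
Local Notation H := (hecke n.+1 q).
Local Notation W := 'S_n.+1.

Lemma qnum_alg m : qnum (q%:A : H) m = (qint q m)%:A.
Proof. exact: (qnum_morph (GRing.in_alg H)). Qed.

Lemma horner_heckeP (b : H) s : perm_eq s (n.+1 :: rev (iota 0 n)) ->
  horner_alg b (heckeP n.+1 q) = \prod_(i <- s) (b - qnum (q%:A) i).
Proof.
move=> /heckeP_roots->; rewrite rmorph_prod; apply: eq_bigr => i _.
by rewrite rmorphB /= horner_algX horner_algC qnum_alg.
Qed.

Lemma roots_perm : perm_eq (rcons (iota 0 n) n.+1) (n.+1 :: rev (iota 0 n)).
Proof. by rewrite perm_rcons perm_cons perm_sym perm_rev. Qed.

Lemma heckeP_heckeB : horner_alg (heckeB n.+1 q) (heckeP n.+1 q) = 0.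
Proof.
rewrite (horner_heckeP _ (perm_refl _)) heckeB_shuffle.
by rewrite (shuffle_annihilated (hecke_family_heckeTn n.+1 q)).
Qed.

Lemma heckeP_heckeBstar : horner_alg (heckeBstar n.+1 q) (heckeP n.+1 q) = 0.
Proof.
rewrite (horner_heckeP _ roots_perm) heckeBstar_shuffle.
by rewrite (shuffle_star_annihilated (hecke_family_heckeTn n.+1 q)).
Qed.

Lemma endmx_spectrum (b : H) (s : seq nat) : perm_eq s (n.+1 :: rev (iota 0 n)) ->
    \prod_(i <- s) (hrho b - (qnum q i)%:M) = 0 :> 'M_#|W| ->
    char_poly (hrho b) = heckeChi n.+1 q ->
  [/\ char_poly (endmx (amulr b)) = heckeChi n.+1 q,
      semisimple_alg H -> diagonalizable (endmx (amulr b))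
    & semisimple_alg H -> \dim (lker (amulr b)) = derangements n.+1].
Proof.
move=> ps ann chi.
have [chiE diagE rankE] :=
  row_full_conj (dim_hecke n q) (row_full_hvec_mx n q) (endmx_hvec_mx b).
have diag (ss : semisimple_alg H) : diagonalizable (hrho b).
  apply: (@annihilated_diagonalizable _ _ _ (map (qint q) s)).
    by rewrite (perm_uniq (perm_map (qint q) ps)) qint_roots_uniq.
  by rewrite big_map.
split; [by rewrite chiE | by move=> /diag/diagE |] => ss.
have [P [d [Pu PA]]] := diagonalizable_decomposition (diag ss).
(* This list comes from B but also describes the eigenvalues of b, since both characteristic
   polynomials are [heckeChi]. *)
have [l ln chil] := regB_roots K n.
have perm : perm_eq [seq d 0 i | i : 'I_#|W|] (map (qnum q) l).
  apply: prod_XsubC_eq; rewrite [RHS]big_map -chil char_poly_regB -chi.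
  by rewrite (char_poly_diagonalized Pu PA) /image_mem big_map big_enum.
have := etrans (dim_lker_endmx (amulr b)) (dim_hecke n q).
rewrite rankE -[RHS](rank_diagonalized Pu PA) addnC => /addnI ->.
rewrite (seq.permP perm) count_map.
(* By semisimplicity only the index 0 gives the eigenvalue 0, so the kernel dimension is the
   multiplicity of that index. *)
rewrite (@eq_in_count _ _ (pred1 0%N)) => [|m ml] /=.
  have chi1 : char_poly (regB n (1 : K)) = \prod_(i <- l) ('X - i%:R%:P).
    by rewrite chil; apply: eq_bigr => i _; rewrite qnum1.
  by rewrite (regB_roots_count ln chi1) // subn0 bin0 mul1n.
have [->|m0] := posnP m; first by rewrite /qnum big_ord0 !eqxx.
have mn : (0 < m <= n.+1)%N by rewrite m0 ln.
by rewrite (negbTE (qint_neq0 ss mn)); apply/esym/negbTE.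
Qed.

End Conclusion.

Theorem theorem4p11 (R : realType) (n : nat) (n_gt0 : (0 < n)%N) (q : R[i]) :
  (horner_alg (heckeBstar n q) (heckeP n q) = 0 /\
   horner_alg (heckeB n q) (heckeP n q) = 0) /\
  (char_poly (endmx (amulr (heckeBstar n q))) = heckeChi n q /\
   char_poly (endmx (amulr (heckeB n q))) = heckeChi n q) /\
  (semisimple_alg (hecke n q) ->
   diagonalizable (endmx (amulr (heckeBstar n q))) /\
   diagonalizable (endmx (amulr (heckeB n q)))) /\
  (semisimple_alg (hecke n q) ->
   \dim (lker (amulr (heckeBstar n q))) = derangements n /\
   \dim (lker (amulr (heckeB n q))) = derangements n).
Proof.
case: n n_gt0 => // n _.
have [||cs ds ks] := endmx_spectrum (b := heckeBstar n.+1 q) (roots_perm n).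
- by rewrite hrho_heckeBstar regBstar_annihilated.
- by rewrite hrho_heckeBstar char_poly_regBstar.
have [||c d k] := endmx_spectrum (b := heckeB n.+1 q) (perm_refl _).
- by rewrite hrho_heckeB regB_annihilated.
- by rewrite hrho_heckeB char_poly_regB.
split; first by split; [exact: heckeP_heckeBstar | exact: heckeP_heckeB].
split; first by split; [exact: cs | exact: c].
by split=> ss; split; [exact: ds | exact: d | exact: ks | exact: k].
Qed.
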